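(* Let $n\ge 4$. Then the set $$\mathcal{G}_n=\{\zeta_{12},\zeta_{13},\zeta_{23},\tau\}\cup\bigcup_{k=4}^{n}\{\xi^{(k)}_1,\xi^{(k)}_2,\xi^{(k)}_3,\xi^{(k)}_4\}$$ of $4n-8$ absolute first-order joint projective invariants is algebraically independent over $\mathbb{R}$ and forms a transcendence basis for the field $\mathcal{I}_{n,0}$ that generates it: $$\mathcal{I}_{n,0}=\mathbb{R}(\mathcal{G}_n).$$
   Context: Let $\mathcal{M}=(\mathbb{R}^2\times\mathbb{R}^2)^n$ be the $n$-fold first-order jet space of point configurations, with coordinates $\boldsymbol{x}=(x_i,y_i,p_i,q_i)_{i=1}^n$, where $(p_i,q_i)$ represents the gradient $(\partial_x u,\partial_y u)$ of a function $u$ at $(x_i,y_i)$. The group $G=PGL(3,\mathbb{R})$ acts (rationally, i.e. where denominators do not vanish) on $\mathcal{M}$: for $g=[T]$ with $T=\begin{pmatrix} a_1&a_2&a_3\\ b_1&b_2&b_3\\ c_1&c_2&c_3\end{pmatrix}\in GL(3,\mathbb{R})$, $$\widetilde x_i=\frac{a_1x_i+a_2y_i+a_3}{c_1x_i+c_2y_i+c_3},\qquad \widetilde y_i=\frac{b_1x_i+b_2y_i+b_3}{c_1x_i+c_2y_i+c_3},$$ and $(\widetilde p_i,\widetilde q_i)$ is given by the standard first prolongation (chain rule for $u(x,y)=\widetilde u(\widetilde x,\widetilde y)$): $p_i=\widetilde p_i\,\partial_x\widetilde x+\widetilde q_i\,\partial_x\widetilde y$ and $q_i=\widetilde p_i\,\partial_y\widetilde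 x+\widetilde q_i\,\partial_y\widetilde y$, where the partial derivatives of the projective map are evaluated at $(x_i,y_i)$. The same $g$ acts on all $n$ blocks. $\mathcal{I}_{n,0}$ denotes the field of absolute invariants: all $F\in\mathbb{R}(x_i,y_i,p_i,q_i\mid i=1,\dots,n)$ with $F(g\cdot\boldsymbol{x})=F(\boldsymbol{x})$ for all $g\in G$ (as rational functions of $\boldsymbol{x}$). Notation: for $i\ne j$, $\Phi^{(k)}_{ij}=\Phi^{(k)}_{i,j}=(x_i-x_j)p_k+(y_i-y_j)q_k$, and $\delta_{ijk}=\begin{vmatrix} x_i&x_j&x_k\\ y_i&y_j&y_k\\ 1&1&1\end{vmatrix}$. Put $$\zeta_{12}=\Phi^{(1)}_{12}\Phi^{(2)}_{12},\quad \zeta_{23}=\Phi^{(2)}_{23}\Phi^{(3)}_{23},\quad \zeta_{13}=\Phi^{(1)}_{13}\Phi^{(3)}_{13},\quad \tau=\Phi^{(1)}_{13}\Phi^{(3)}_{23}\Phi^{(2)}_{12},$$ and for $k\ge 4$ $$\xi^{(k)}_1=\frac{\delta_{123}\,\Phi^{(1)}_{1,k}}{\delta_{23k}},\qquad \xi^{(k)}_2=\frac{\delta_{12k}\,\Phi^{(1)}_{1,3}}{\delta_{23k}},$$ $$\xi^{(k)}_3=\frac{\bigl(\delta_{23k}+\delta_{123}\,\Phi^{(1)}_{1,k}\bigr)\bigl(\Phi^{(k)}_{1,k}\Phi^{(1)}_{1,2}-\Phi^{(k)}_{2,k}\bigr)}{\delta_{123}\,\Phi^{(1)}_{1,2}},$$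 $$\xi^{(k)}_4=\frac{\Phi^{(1)}_{1,k}\Phi^{(k)}_{2,3}+\delta_{23k}(p_1q_k-p_kq_1)}{\Phi^{(1)}_{1,3}\bigl(\Phi^{(k)}_{1,k}\Phi^{(1)}_{1,2}-\Phi^{(k)}_{2,k}\bigr)}.$$ *)

(* Defs.v *)
From HB Require Import structures.
From mathcomp Require Import all_boot all_order all_algebra.
From mathcomp Require Import ring.
From mathcomp Require Import reals mpoly.

Set Implicit Arguments.
Unset Strict Implicit.
Unset Printing Implicit Defensive.

Import GRing.Theory FracField.
Local Open Scope ring_scope.

(* A configuration of n first-order jets is an n x 4
   matrix whose i-th row is (x_i, y_i, p_i, q_i).  Points are indexed from 0. *)

Notation "{ 'ratfun' R [ N ] }" := {fraction {mpoly R[N]}}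
  (at level 0, R at level 2, N at level 2,
   format "{ 'ratfun'  R [ N ] }") : type_scope.

Local Notation "x %:F" := (tofrac x).

Lemma tofrac_div_eq (A : idomainType) (p q p' q' : A) : q != 0 -> q' != 0 ->
  p%:F / q%:F = p'%:F / q'%:F -> p * q' = p' * q.
Proof.
move=> q0 q'0 /eqP; rewrite eqr_div ?tofrac_eq0 // -!tofracM tofrac_eq.
by move/eqP.
Qed.

Lemma tofrac_div_eq' (A : idomainType) (p q p' q' : A) : q != 0 -> q' != 0 ->
  p * q' = p' * q -> p%:F / q%:F = p'%:F / q'%:F.
Proof.
move=> q0 q'0 E; apply/eqP.
by rewrite eqr_div ?tofrac_eq0 // -!tofracM tofrac_eq E.
Qed.

Section RationalFunctions.

Variables (R : realType) (N : nat).
Local Notation K := {ratfun R[N]}.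
Implicit Types (P Q : {mpoly R[N]}) (F : K) (v : 'I_N).

Definition ratC (c : R) : K := (c%:MP)%:F.

HB.instance Definition _ :=
  GRing.RMorphism.copy ratC (@tofrac {mpoly R[N]} \o @mpolyC N R).

Definition ratX v : K := ('X_v : {mpoly R[N]})%:F.

Lemma ratfun_repr F :
  \d_(repr F) != 0 /\ F = (\n_(repr F))%:F / (\d_(repr F))%:F.
Proof.
split; first exact: denom_ratioP.
have key (r : {ratio {mpoly R[N]}}) : (\pi r : K)%qT * (\d_r)%:F = (\n_r)%:F.
  have d0 := denom_ratioP r.
  unlock tofrac; rewrite -[LHS]pi_mul; apply/eqmodP; rewrite /= equivfE /mulf.
  by rewrite !numden_Ratio ?(oner_neq0, mulf_neq0) //= !mulr1 mulrC.
have dF : (\d_(repr F))%:F != 0 :> K by rewrite tofrac_eq0 denom_ratioP.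
by apply: (mulIf dF); rewrite divfK // -key reprK.
Qed.

(* Partial derivative with respect to X_v, by the quotient rule on a
   representative; the value does not depend on it, see [ratderiv_quot]. *)
Definition ratderiv v F : K :=
  let P := \n_(repr F) in let Q := \d_(repr F) in
  (mderiv v P * Q - P * mderiv v Q)%:F / Q%:F ^+ 2.

Lemma ratderiv_quot v P Q : Q != 0 ->
  ratderiv v (P%:F / Q%:F) = (mderiv v P * Q - P * mderiv v Q)%:F / Q%:F ^+ 2.
Proof.
move=> Q0; have [D0 E] := ratfun_repr (P%:F / Q%:F).
rewrite /ratderiv; move: D0 E.
set A := \n_ _; set D := \d_ _ => D0 E.
have Q0' : Q%:F != 0 :> K by rewrite tofrac_eq0.
have D0' : D%:F != 0 :> K by rewrite tofrac_eq0.
have {}E : P * D = A * Q.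
  exact: tofrac_div_eq E.
have dE : mderiv v P * D + P * mderiv v D = mderiv v A * Q + A * mderiv v Q.
  by rewrite -!mderivM E.
rewrite -!tofracXn; apply: tofrac_div_eq'; rewrite ?expf_neq0 //.
have -> : (mderiv v A * D - A * mderiv v D) * Q ^+ 2 =
   (mderiv v A * Q) * D * Q - (A * Q) * mderiv v D * Q by ring.
have -> : mderiv v A * Q = mderiv v P * D + P * mderiv v D - A * mderiv v Q.
  by rewrite dE addrK.
rewrite -E.
have -> : (mderiv v P * D + P * mderiv v D - A * mderiv v Q) * D * Q =
  (mderiv v P * D + P * mderiv v D) * D * Q - (A * Q) * mderiv v Q * D by ring.
by rewrite -E; ring.
Qed.

(* F(h): substitution of the rational function h v for each variable X_v.
   When substitution of h into polynomials is injective (as it is when h is a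
   birational map), this does not depend on the representative of F, see
   [ratsubst_quot]; otherwise the convention x / 0 = 0 may apply. *)
Definition ratsubst (h : 'I_N -> K) F : K :=
  mmap ratC h (\n_(repr F)) / mmap ratC h (\d_(repr F)).

Lemma ratsubst_quot (h : 'I_N -> K) P Q :
  (forall P', mmap ratC h P' = 0 -> P' = 0) -> Q != 0 ->
  ratsubst h (P%:F / Q%:F) = mmap ratC h P / mmap ratC h Q.
Proof.
move=> hI Q0; have [D0 E] := ratfun_repr (P%:F / Q%:F).
rewrite /ratsubst; move: D0 E.
set A := \n_ _; set D := \d_ _ => D0 E.
have Q0' : Q%:F != 0 :> K by rewrite tofrac_eq0.
have D0' : D%:F != 0 :> K by rewrite tofrac_eq0.
have {}E : P * D = A * Q.
  exact: tofrac_div_eq E.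
have nz P' : P' != 0 -> mmap ratC h P' != 0.
  by apply: contra_neq; exact: hI.
by apply/eqP; rewrite eqr_div ?nz // -!rmorphM E.
Qed.

End RationalFunctions.

Section Fields.

Variables (R : realType) (N : nat).
Local Notation K := {ratfun R[N]}.
Implicit Types (S : seq K) (L : K -> Prop).

(* R(S): the smallest subfield of K containing the constants and S.  Boolean
   predicates D represent all subsets of K, classically. *)
Definition gen_field S : K -> Prop := fun F =>
  forall D : {pred K}, GRing.divring_closed D ->
    (forall c : R, ratC N c \in D) -> {subset S <= D} -> F \in D.

(* Algebraic independence over R of the family of entries of S; in particular
   the entries are pairwise distinct. *)
Definition alg_indep S : Prop :=
  forall P : {mpoly R[size S]},
    mmap (ratC N) (fun i : 'I_(size S) => S`_i) P = 0 -> P = 0.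

Definition algebraic_over L (F : K) : Prop :=
  exists P : {poly K}, [/\ P != 0, forall i, L P`_i & root P F].

Definition transcendence_basis S L : Prop :=
  [/\ forall F, F \in S -> L F,
      alg_indep S &
      forall F, L F -> algebraic_over (gen_field S) F].

End Fields.

Section ProjectiveAction.

Variables (R : realType) (n : nat).
Local Notation K := {ratfun R[n * 4]}.

Definition jet_var (i : 'I_n) (c : 'I_4) : 'I_(n * 4) := mxvec_index i c.

Definition generic_config : 'M[K]_(n, 4) :=
  \matrix_(i, c) ratX R (jet_var i c).

Variable T : 'M[R]_3.
Local Notation X := generic_config.

(* r-th entry of T (x_i, y_i, 1)^T *)
Definition hom_coord (i : 'I_n) (r : 'I_3) : K :=
  ratC _ (T r 0) * X i 0 + ratC _ (T r 1) * X i 1 + ratC _ (T r 2).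

Definition proj_x i : K := hom_coord i 0 / hom_coord i 2.
Definition proj_y i : K := hom_coord i 1 / hom_coord i 2.

Definition proj_jacobian i : 'M[K]_2 :=
  \matrix_(r, s) ratderiv (jet_var i (if s == 0 then 0 else 1))
                          (if r == 0 then proj_x i else proj_y i).

(* The chain rule reads (p, q) = (p~, q~) J, and J is invertible when T is, see
   [proj_chain_rule]. *)
Definition proj_grad i : 'rV[K]_2 :=
  (\row_s X i (if s == 0 then 2 else 3)) *m invmx (proj_jacobian i).

Definition proj_config : 'M[K]_(n, 4) :=
  \matrix_(i, c) [:: proj_x i; proj_y i; proj_grad i 0 0; proj_grad i 0 1]`_c.

(* F |-> F(g . x), for g = [T] *)
Definition proj_subst (F : K) : K :=
  ratsubst (fun v => mxvec proj_config 0 v) F.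

End ProjectiveAction.

Lemma det2E (A : comPzRingType) (M : 'M[A]_2) :
  \det M = M 0 0 * M 1 1 - M 0 1 * M 1 0.
Proof.
rewrite (expand_det_row _ 0) !big_ord_recl big_ord0 /cofactor !det_mx11 !mxE /=.
have -> : ord0 = 0 :> 'I_2 by [].
have -> : lift 0 0 = 1 :> 'I_2 by apply: val_inj.
have -> : lift 1 0 = 0 :> 'I_2 by apply: val_inj.
by rewrite expr0 expr1 addr0 mul1r mulN1r mulrN.
Qed.

Lemma det3E (A : comPzRingType) (M : 'M[A]_3) :
  \det M = M 0 0 * (M 1 1 * M 2 2 - M 1 2 * M 2 1)
         - M 0 1 * (M 1 0 * M 2 2 - M 1 2 * M 2 0)
         + M 0 2 * (M 1 0 * M 2 1 - M 1 1 * M 2 0).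
Proof.
rewrite (expand_det_row _ 0) !big_ord_recl big_ord0 /cofactor !det2E !mxE /=.
have e0 : ord0 = 0 :> 'I_3 by [].
have e1 : lift ord0 ord0 = 1 :> 'I_3 by apply: val_inj.
have e2 : lift ord0 (lift ord0 ord0) = 2 :> 'I_3 by apply: val_inj.
have f0 : lift 0 0 = 1 :> 'I_3 by apply: val_inj.
have f1 : lift 0 1 = 2 :> 'I_3 by apply: val_inj.
have g0 : lift 1 0 = 0 :> 'I_3 by apply: val_inj.
have g1 : lift 1 1 = 2 :> 'I_3 by apply: val_inj.
have h0 : lift 2 0 = 0 :> 'I_3 by apply: val_inj.
have h1 : lift 2 1 = 1 :> 'I_3 by apply: val_inj.
rewrite ?e2 ?e1 ?e0 ?f0 ?f1 ?g0 ?g1 ?h0 ?h1 /=.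
by rewrite expr0 expr1 sqrrN expr1n addr0 !mul1r !mulN1r mulrN addrA.
Qed.

Lemma jacobian_det_eq (F : fieldType) (a1 a2 a3 b1 b2 b3 c1 c2 c3 x y h k w : F) :
  h = a1 * x + a2 * y + a3 -> k = b1 * x + b2 * y + b3 ->
  w = c1 * x + c2 * y + c3 -> w != 0 ->
  (a1 * w - h * c1) / w ^+ 2 * ((b2 * w - k * c2) / w ^+ 2)
  - (a2 * w - h * c2) / w ^+ 2 * ((b1 * w - k * c1) / w ^+ 2)
  = (a1 * (b2 * c3 - b3 * c2) - a2 * (b1 * c3 - b3 * c1)
     + a3 * (b1 * c2 - b2 * c1)) / w ^+ 3.
Proof.
move=> -> -> ew w0.
have -> : c3 = w - c1 * x - c2 * y by rewrite ew; ring.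
by field.
Qed.

Section ChainRule.

Variables (R : realType) (n : nat) (T : 'M[R]_3).
Local Notation K := {ratfun R[n * 4]}.
Local Notation C := (ratC (n * 4)).
Local Notation X := (generic_config R n).

Let hom_poly (i : 'I_n) (r : 'I_3) : {mpoly R[n * 4]} :=
  (T r 0)%:MP * 'X_(jet_var i 0) + (T r 1)%:MP * 'X_(jet_var i 1) + (T r 2)%:MP.

Let hom_polyE i r : hom_coord T i r = (hom_poly i r)%:F.
Proof. by rewrite /hom_coord !mxE /hom_poly !tofracD !tofracM. Qed.

Lemma jet_var_inj (i : 'I_n) : injective (jet_var i).
Proof. by move=> c d /cast_ord_inj/enum_rank_inj[]. Qed.

Let dX (i : 'I_n) (c d : 'I_4) :
  mderiv (jet_var i c) ('X_(jet_var i d) : {mpoly R[n * 4]}) = (c == d)%:R.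
Proof.
rewrite mderivX mnmE (inj_eq (@jet_var_inj i)) eq_sym.
case: eqVneq => [->|_]; last by rewrite scale0r.
by rewrite scale1r -{1}[U_(_)%MM]add0m addmK mpolyX0.
Qed.

Let dhom (i : 'I_n) (r : 'I_3) :
  (mderiv (jet_var i 0) (hom_poly i r) = (T r 0)%:MP) *
  (mderiv (jet_var i 1) (hom_poly i r) = (T r 1)%:MP).
Proof.
split; rewrite /hom_poly !mderivD !mderiv_mulC mderivC !dX /=;
by rewrite ?mulr1 ?mulr0 ?addr0 ?add0r.
Qed.

Hypothesis uT : T \in unitmx.

Lemma hom_coord2_neq0 (i : 'I_n) : hom_coord T i 2 != 0.
Proof.
rewrite hom_polyE tofrac_eq0; apply/eqP => h0.
have t0 : T 2 0 = 0.
  have := (dhom i 2).1; rewrite h0 mderiv0 => /esym/eqP.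
  by rewrite mpolyC_eq0 => /eqP.
have t1 : T 2 1 = 0.
  have := (dhom i 2).2; rewrite h0 mderiv0 => /esym/eqP.
  by rewrite mpolyC_eq0 => /eqP.
have t2 : T 2 2 = 0.
  move: h0; rewrite /hom_poly t0 t1 !mul0r !add0r => /eqP.
  by rewrite mpolyC_eq0 => /eqP.
move: uT; rewrite unitmxE unitfE (_ : \det T = 0) ?eqxx // det3E t0 t1 t2.
by ring.
Qed.

Lemma ratderiv_hom (i : 'I_n) (r : 'I_3) :
  (ratderiv (jet_var i 0) (hom_coord T i r / hom_coord T i 2)
   = (C (T r 0) * hom_coord T i 2 - hom_coord T i r * C (T 2 0))
      / hom_coord T i 2 ^+ 2) *
  (ratderiv (jet_var i 1) (hom_coord T i r / hom_coord T i 2)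
   = (C (T r 1) * hom_coord T i 2 - hom_coord T i r * C (T 2 1))
      / hom_coord T i 2 ^+ 2).
Proof.
have := hom_coord2_neq0 i; rewrite !hom_polyE tofrac_eq0 => w0.
by split; rewrite ratderiv_quot // !dhom tofracB !tofracM.
Qed.

Lemma det_proj_jacobian i :
  \det (proj_jacobian T i) = C (\det T) / hom_coord T i 2 ^+ 3.
Proof.
have w0 := hom_coord2_neq0 i.
rewrite det2E !mxE /= /proj_x /proj_y !ratderiv_hom det3E.
rewrite !(rmorphD, rmorphB, rmorphN, rmorphM) /=.
by apply: jacobian_det_eq w0; rewrite /hom_coord.
Qed.

Lemma proj_jacobian_unit (i : 'I_n) : proj_jacobian T i \in unitmx.
Proof.
rewrite unitmxE unitfE det_proj_jacobian mulf_neq0 //; last first.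
  by rewrite invr_eq0 expf_neq0 // hom_coord2_neq0.
by rewrite fmorph_eq0 -unitfE -unitmxE.
Qed.

Lemma proj_chain_rule (i : 'I_n) :
  X i 2 = proj_config n T i 2 * ratderiv (jet_var i 0) (proj_x T i)
        + proj_config n T i 3 * ratderiv (jet_var i 0) (proj_y T i) /\
  X i 3 = proj_config n T i 2 * ratderiv (jet_var i 1) (proj_x T i)
        + proj_config n T i 3 * ratderiv (jet_var i 1) (proj_y T i).
Proof.
have J : proj_grad T i *m proj_jacobian T i =
    \row_s X i (if s == 0 then 2 else 3) by rewrite mulmxKV // proj_jacobian_unit.
have e1 : lift ord0 ord0 = 1 :> 'I_2 by apply: val_inj.
have E s : X i (if s == 0 then 2 else 3) =
    proj_grad T i 0 0 * proj_jacobian T i 0 s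
    + proj_grad T i 0 1 * proj_jacobian T i 1 s.
  have := congr1 (fun M : 'rV_2 => M 0 s) J.
  by rewrite mxE [RHS]mxE => <-; rewrite !big_ord_recl big_ord0 addr0 e1.
have pE : proj_config n T i 2 = proj_grad T i 0 0 by rewrite mxE.
have qE : proj_config n T i 3 = proj_grad T i 0 1 by rewrite mxE.
have JE r s : proj_jacobian T i r s =
  ratderiv (jet_var i (if s == 0 then 0 else 1))
           (if r == 0 then proj_x T i else proj_y T i) by rewrite mxE.
by rewrite pE qE; split; [have := E 0 | have := E 1]; rewrite !JE.
Qed.

End ChainRule.

(* The action of T depends only on its class in PGL(3, R). *)
Lemma proj_config_scale (R : realType) (n : nat) (T : 'M[R]_3) (c : R) :
  c != 0 -> proj_config n (c *: T) = proj_config n T.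
Proof.
move=> c0; have C0 : ratC (n * 4) c != 0 by rewrite fmorph_eq0.
have hE (i : 'I_n) r : hom_coord (c *: T) i r = ratC _ c * hom_coord T i r.
  by rewrite /hom_coord !mxE !rmorphM /= -!mulrA -!mulrDr.
have xE (i : 'I_n) : proj_x (c *: T) i = proj_x T i.
  by rewrite /proj_x !hE -mulf_div divff // mul1r.
have yE (i : 'I_n) : proj_y (c *: T) i = proj_y T i.
  by rewrite /proj_y !hE -mulf_div divff // mul1r.
have gE (i : 'I_n) : proj_grad (c *: T) i = proj_grad T i.
  by congr (_ *m invmx _); apply/matrixP => r s; rewrite !mxE xE yE.
have key (a b u v a' b' u' v' : {ratfun R[n * 4]}) (m : nat) :
    a = a' -> b = b' -> u = u' -> v = v' -> [:: a; b; u; v]`_m = [:: a'; b'; u'; v']`_m.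
  by move=> -> -> -> ->.
have cE (T' : 'M[R]_3) (i : 'I_n) k : proj_config n T' i k =
    [:: proj_x T' i; proj_y T' i; proj_grad T' i 0 0; proj_grad T' i 0 1]`_k.
  by rewrite mxE.
apply/matrixP => i k.
refine (etrans (cE _ i k) (etrans _ (esym (cE T i k)))).
refine (key _ _ _ _ _ _ _ _ k (xE i) (yE i) _ _).
  exact: (congr1 (fun M : 'rV_2 => M 0 0) (gE i)).
exact: (congr1 (fun M : 'rV_2 => M 0 1) (gE i)).
Qed.

(* The field I_{n,0}; T ranges over the representatives of PGL(3, R). *)
Definition abs_invariant (R : realType) (n : nat) (F : {ratfun R[n * 4]}) : Prop :=
  forall T : 'M[R]_3, T \in unitmx -> proj_subst T F = F.

Section Generators.

Variables (R : realType) (n : nat).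
Local Notation K := {ratfun R[n * 4]}.
Implicit Types i j k : 'I_n.

Local Notation x i := (generic_config R n i 0).
Local Notation y i := (generic_config R n i 1).
Local Notation p i := (generic_config R n i 2).
Local Notation q i := (generic_config R n i 3).

(* Phi k i j is $\Phi^{(k)}_{ij}$ *)
Definition Phi k i j : K := (x i - x j) * p k + (y i - y j) * q k.

Definition delta i j k : K :=
  \det (\matrix_(r < 3, c < 3)
    (nth [::] [:: [:: x i; x j; x k];
                  [:: y i; y j; y k];
                  [:: 1;   1;   1  ]] r)`_c).

Definition zeta i j : K := Phi i i j * Phi j i j.

Section Xi.

Variables i1 i2 i3 : 'I_n.

Definition tau : K := Phi i1 i1 i3 * Phi i3 i2 i3 * Phi i2 i1 i2.

Definition xi1 k : K := delta i1 i2 i3 * Phi i1 i1 k / delta i2 i3 k.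

Definition xi2 k : K := delta i1 i2 k * Phi i1 i1 i3 / delta i2 i3 k.

Definition xi3 k : K :=
  (delta i2 i3 k + delta i1 i2 i3 * Phi i1 i1 k)
    * (Phi k i1 k * Phi i1 i1 i2 - Phi k i2 k)
  / (delta i1 i2 i3 * Phi i1 i1 i2).

Definition xi4 k : K :=
  (Phi i1 i1 k * Phi k i2 i3 + delta i2 i3 k * (p i1 * q k - p k * q i1))
  / (Phi i1 i1 i3 * (Phi k i1 k * Phi i1 i1 i2 - Phi k i2 k)).

End Xi.

Definition generators (hn : (4 <= n)%N) : seq K :=
  let i1 := widen_ord hn 0 in
  let i2 := widen_ord hn 1 in
  let i3 := widen_ord hn 2 in
  [:: zeta i1 i2; zeta i1 i3; zeta i2 i3; tau i1 i2 i3] ++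
  flatten [seq [:: xi1 i1 i2 i3 k; xi2 i1 i2 i3 k; xi3 i1 i2 i3 k; xi4 i1 i2 i3 k]
          | k <- enum 'I_n & (3 <= k)%N].

End Generators.

(* Main.v *)
Require Import Defs.
From mathcomp Require Import all_boot all_order all_algebra.
From mathcomp Require Import ring zify.
From mathcomp Require Import boolp reals mpoly.

(** The proof is the moving frame method, carried out over an arbitrary field E
    so that the same statements serve for real configurations, for the generic
    configuration X with entries in K = R(x_i, y_i, p_i, q_i), and for
    configurations whose entries are new indeterminates.

    Attach to the i-th jet the homogeneous point (x_i, y_i, 1) and the line
    (p_i, q_i, - x_i p_i - y_i q_i) through it.  A matrix T multiplies the
    points by T and the lines by the inverse of T, up to the weight
    w_i = c_1 x_i + c_2 y_i + c_3 ([point_act], [line_act]).  Hence the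
    incidence inc i j = - line_i point_j (that is, Phi^(i)_ij) is multiplied by
    w_i / w_j and the area delta_ijk by det T / (w_i w_j w_k).  Every generator
    is an expression in incidences and areas in which the weights cancel, so it
    is invariant ([invs_act]).

    Let T_X be the frame ([moving_frame]), a matrix with entries in K which
    brings the first jet of X to (0, 0, 1, 1) and the next two points to (-1, 0)
    and (0, -1).  On such normalized configurations the generators are
    coordinates: every entry is an explicit rational function of them, and they
    can be prescribed freely ([normalizedE], [invs_cross_section]).

    Algebraic independence follows: evaluate a relation between the generators
    at the normalized configuration on which they take the values of
    independent variables ([invs_alg_indep]).

    Generation follows as well.  The entries of s = T_X X lie in the field
    generated by the invariants.  If F = P / Q is invariant, then
    P(T X) Q(X) = Q(T X) P(X) for all real T.  This is a polynomial identity in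
    T after clearing denominators, hence it persists for all T with entries in
    K ([act_vanish]).  One would like to take T = T_X, but Q might vanish at s.
    It does not vanish at g s for some real g, since otherwise, by the same
    density argument, it would vanish at T_X^-1 s = X.  Then
    F = P(g s) / Q(g s) is a rational function of the generators
    ([invariant_gen_field]). *)

Set Implicit Arguments.
Unset Strict Implicit.
Unset Printing Implicit Defensive.

Import GRing.Theory.
Local Open Scope ring_scope.

Local Notation "x %:F" := (tofrac x).

(** * Values of rational functions *)

Section Values.

Variables (R : realType) (N : nat) (E : fieldType).
Variables (phi : {rmorphism R -> E}) (v : 'I_N -> E).
Local Notation K := {ratfun R[N]}.
Implicit Types (F G : K) (c d : E) (P Q : {mpoly R[N]}).

(** A relation rather than a function: F has a value at v only when some
    representation of F has a denominator that survives at v, so that values are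
    compatible with all field operations. *)
Definition has_value F c := exists P Q,
  [/\ mmap phi v Q != 0, F = P%:F / Q%:F & c = mmap phi v P / mmap phi v Q].

Lemma mmap_nz Q : mmap phi v Q != 0 -> Q%:F != 0 :> K.
Proof.
by apply: contra_neq => /eqP; rewrite tofrac_eq0 => /eqP->; rewrite rmorph0.
Qed.

Lemma has_value_inj F c d : has_value F c -> has_value F d -> c = d.
Proof.
move=> [P [Q [Q0 -> ->]]] [P' [Q' [Q'0 /tofrac_div_eq e ->]]].
have {}e : P * Q' = P' * Q by apply: e; rewrite -(tofrac_eq0); apply: mmap_nz.
by apply/eqP; rewrite eqr_div // -!rmorphM e.
Qed.

Lemma has_value_poly P : has_value P%:F (mmap phi v P).
Proof.
by exists P, 1; rewrite !rmorph1 oner_neq0 !divr1.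
Qed.

Lemma has_valueC a : has_value (ratC N a) (phi a).
Proof. by have := has_value_poly a%:MP; rewrite mmapC. Qed.

Lemma has_valueX i : has_value (ratX R i) (v i).
Proof. by have := has_value_poly 'X_i; rewrite mmapX mmap1U. Qed.

Lemma has_value0 : has_value 0 0.
Proof. by have := has_valueC 0; rewrite !rmorph0. Qed.

Lemma has_value1 : has_value 1 1.
Proof. by have := has_valueC 1; rewrite !rmorph1. Qed.

Lemma has_valueD F G c d :
  has_value F c -> has_value G d -> has_value (F + G) (c + d).
Proof.
move=> [P [Q [Q0 -> ->]]] [P' [Q' [Q'0 -> ->]]].
exists (P * Q' + P' * Q), (Q * Q'); split; first by rewrite rmorphM mulf_neq0.
  by rewrite rmorphD !rmorphM addf_div //; apply: mmap_nz.
by rewrite rmorphD !rmorphM addf_div.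
Qed.

Lemma has_valueM F G c d :
  has_value F c -> has_value G d -> has_value (F * G) (c * d).
Proof.
move=> [P [Q [Q0 -> ->]]] [P' [Q' [Q'0 -> ->]]].
exists (P * P'), (Q * Q'); split; first by rewrite rmorphM mulf_neq0.
  by rewrite !rmorphM mulf_div.
by rewrite !rmorphM mulf_div.
Qed.

Lemma has_valueN F c : has_value F c -> has_value (- F) (- c).
Proof.
move=> [P [Q [Q0 -> ->]]]; exists (- P), Q; split=> //.
  by rewrite rmorphN mulNr.
by rewrite rmorphN mulNr.
Qed.

Lemma has_valueB F G c d :
  has_value F c -> has_value G d -> has_value (F - G) (c - d).
Proof. by move=> hF hG; apply/has_valueD/has_valueN. Qed.

Lemma has_valueV F c : c != 0 -> has_value F c -> has_value F^-1 c^-1.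
Proof.
move=> c0 [P [Q [Q0 -> ce]]]; exists Q, P; split.
- by apply: contra_neq c0; rewrite ce => ->; rewrite mul0r.
- by rewrite invf_div.
- by rewrite ce invf_div.
Qed.

Lemma has_value_div F G c d : d != 0 ->
  has_value F c -> has_value G d -> has_value (F / G) (c / d).
Proof. by move=> d0 hF hG; apply/has_valueM/has_valueV. Qed.

Lemma has_value_neq0 F c : has_value F c -> c != 0 -> F != 0.
Proof.
move=> h; apply: contra_neq => F0; rewrite F0 in h.
exact: has_value_inj has_value0.
Qed.

(** The composition rule: it evaluates at a configuration what has first been
    substituted by the projective action. *)
Lemma has_value_mmap m (h : 'I_m -> K) (c : 'I_m -> E) (P : {mpoly R[m]}) :
  (forall i, has_value (h i) (c i)) ->
  has_value (mmap (ratC N) h P) (mmap phi c P).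
Proof.
move=> hc; elim/mpolyind: P => [|a mm P _ _ IH].
  by rewrite !rmorph0; apply: has_value0.
rewrite !rmorphD /=; apply: has_valueD IH.
rewrite !mmapZ !mmapX; apply: has_valueM; first exact: has_valueC.
rewrite /mmap1; elim/big_ind2: _ => [|F d G e|i _]; first exact: has_value1.
  exact: has_valueM.
elim: (mm i) => [|j IH]; first by rewrite !expr0; apply: has_value1.
by rewrite !exprS; apply: has_valueM.
Qed.

End Values.

Lemma mmap_ratX (R : realType) N (P : {mpoly R[N]}) :
  mmap (ratC N) (@ratX R N) P = P%:F.
Proof.
elim/mpolyind: P => [|a mm P _ _ IH]; first by rewrite !rmorph0.
rewrite !rmorphD /= IH mmapZ -mul_mpolyC rmorphM mmapX /mmap1 mpolyXE_id.
rewrite rmorph_prod.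
by congr (_ * _ + _); apply: eq_bigr => i _; rewrite rmorphXn.
Qed.

Lemma has_value_mxvec (R : realType) N (E : fieldType) (phi : {rmorphism R -> E})
    (v : 'I_N -> E) m k (A : 'M[{ratfun R[N]}]_(m, k)) (B : 'M[E]_(m, k)) :
  (forall i j, has_value phi v (A i j) (B i j)) ->
  forall u, has_value phi v (mxvec A 0 u) (mxvec B 0 u).
Proof. by move=> h u; case/mxvec_indexP: u => i j; rewrite !mxvecE. Qed.

(** * The projective action over an arbitrary field *)

Section Configurations.

Variables (E : fieldType) (n : nat).
Implicit Types (T S : 'M[E]_3) (M : 'M[E]_(n, 4)) (i j k : 'I_n).

Definition point M i : 'cV[E]_3 := \col_r [:: M i 0; M i 1; 1]`_r.

Definition line M i : 'rV[E]_3 :=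
  \row_r [:: M i 2; M i 3; - (M i 0 * M i 2 + M i 1 * M i 3)]`_r.

(** This is Phi^(i)_ij. It vanishes when the line of the i-th jet passes through
    the j-th point, see [line_point]. *)
Definition inc M i j : E := (M i 0 - M j 0) * M i 2 + (M i 1 - M j 1) * M i 3.

Definition area M i j k : E :=
  M i 0 * (M j 1 - M k 1) - M j 0 * (M i 1 - M k 1) + M k 0 * (M i 1 - M j 1).

Definition weight T M i : E := T 2 0 * M i 0 + T 2 1 * M i 1 + T 2 2.

Definition act T M : 'M[E]_(n, 4) := \matrix_(i, c)
  [:: (T *m point M i) 0 0 / weight T M i;
      (T *m point M i) 1 0 / weight T M i;
      weight T M i * (line M i *m invmx T) 0 0;
      weight T M i * (line M i *m invmx T) 0 1]`_c.

(** The domain of the rational action of GL_3. *)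
Definition regular_at T M : Prop :=
  T \in unitmx /\ forall i, weight T M i != 0.

Lemma sum3 (f : 'I_3 -> E) : \sum_r f r = f 0 + f 1 + f 2.
Proof.
rewrite !big_ord_recl big_ord0 addr0 addrA.
by congr (_ + f _ + f _); apply: val_inj.
Qed.

Lemma row3_eq (u v : 'rV[E]_3) :
  u 0 0 = v 0 0 -> u 0 1 = v 0 1 -> u 0 2 = v 0 2 -> u = v.
Proof.
move=> h0 h1 h2; apply/rowP; case; case=> [|[|[|//]]] lt.
- by rewrite (_ : Ordinal lt = 0) //; apply: val_inj.
- by rewrite (_ : Ordinal lt = 1) //; apply: val_inj.
- by rewrite (_ : Ordinal lt = 2) //; apply: val_inj.
Qed.

Lemma col3_eq (u v : 'cV[E]_3) :
  u 0 0 = v 0 0 -> u 1 0 = v 1 0 -> u 2 0 = v 2 0 -> u = v.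
Proof.
by move=> h0 h1 h2; apply: trmx_inj; apply: row3_eq; rewrite [LHS]mxE [RHS]mxE.
Qed.

Lemma config_eq M M' : (forall i, point M i = point M' i) ->
  (forall i, line M i = line M' i) -> M = M'.
Proof.
move=> hp hl; apply/matrixP => i; case; case=> [|[|[|[|//]]]] lt.
- rewrite (_ : Ordinal lt = 0); last exact: val_inj.
  by have := congr1 (fun u : 'cV_3 => u 0 0) (hp i); rewrite !mxE.
- rewrite (_ : Ordinal lt = 1); last exact: val_inj.
  by have := congr1 (fun u : 'cV_3 => u 1 0) (hp i); rewrite !mxE.
- rewrite (_ : Ordinal lt = 2); last exact: val_inj.
  by have := congr1 (fun u : 'rV_3 => u 0 0) (hl i); rewrite !mxE.
- rewrite (_ : Ordinal lt = 3); last exact: val_inj.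
  by have := congr1 (fun u : 'rV_3 => u 0 1) (hl i); rewrite !mxE.
Qed.

Lemma weightE T M i : weight T M i = (T *m point M i) 2 0.
Proof. by rewrite mxE sum3 !mxE /= mulr1. Qed.

Lemma line_point M i j : (line M i *m point M j) 0 0 = - inc M i j.
Proof. by rewrite mxE sum3 !mxE /= /inc; ring. Qed.

Lemma point_act T M i : regular_at T M ->
  point (act T M) i = (weight T M i)^-1 *: (T *m point M i).
Proof.
case=> _ w0; apply: col3_eq.
- by rewrite [RHS]mxE mulrC !mxE.
- by rewrite [RHS]mxE mulrC !mxE.
- by rewrite [RHS]mxE -weightE mulVf // !mxE.
Qed.

(** The third coordinate is not in the definition of the action; it is
    determined by the first two because the line passes through its point, a
    property that T preserves. *)
Lemma line_act T M i : regular_at T M ->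
  line (act T M) i = weight T M i *: (line M i *m invmx T).
Proof.
move=> rT; have [uT w0] := rT.
pose L : 'rV[E]_3 := weight T M i *: (line M i *m invmx T).
have L0 : (L *m point (act T M) i) 0 0 = 0.
  rewrite point_act // /L -scalemxAl -scalemxAr scalerA divff // scale1r.
  by rewrite -mulmxA mulKmx // line_point /inc !subrr !mul0r addr0 oppr0.
have p2 : point (act T M) i 2 0 = 1 by rewrite mxE.
move: L0; rewrite mxE sum3 p2 mulr1 => /eqP; rewrite addrC addr_eq0 => /eqP L2.
have l0 : line (act T M) i 0 0 = L 0 0 by rewrite mxE /= mxE /= [RHS]mxE.
have l1 : line (act T M) i 0 1 = L 0 1 by rewrite mxE /= mxE /= [RHS]mxE.
apply: row3_eq => //; rewrite -/L L2 -l0 -l1 !mxE /=; ring.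
Qed.

Lemma inc_act T M i j : regular_at T M ->
  inc (act T M) i j = weight T M i / weight T M j * inc M i j.
Proof.
move=> rT; have [uT w0] := rT.
apply: oppr_inj; rewrite -mulrN -!line_point line_act // point_act //.
rewrite -scalemxAl -scalemxAr scalerA [LHS]mxE.
by congr (_ * _); rewrite -mulmxA mulKmx.
Qed.

Lemma area_act T M i j k : regular_at T M ->
  area (act T M) i j k =
  \det T / (weight T M i * weight T M j * weight T M k) * area M i j k.
Proof.
case=> _ w0; have := (w0 i, w0 j, w0 k).
rewrite /area det3E !mxE /= ?mxE !sum3 !mxE /= /weight !mulr1 => -[[wi wj] wk].
by field; rewrite wi wj wk.
Qed.

(** The weights form a cocycle, which is what makes the action multiplicative. *)
Lemma weight_mul T S M i : regular_at S M ->
  weight (T *m S) M i = weight T (act S M) i * weight S M i.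
Proof.
move=> rS; have [_ w0] := rS.
rewrite [LHS]weightE [weight T _ _]weightE point_act // -mulmxA -scalemxAr.
by rewrite [in RHS]mxE mulrC mulVKf.
Qed.

Lemma regular_mul T S M : regular_at S M ->
  regular_at T (act S M) -> regular_at (T *m S) M.
Proof.
move=> rS [uT wT]; have [uS wS] := rS; split.
  by rewrite unitmx_mul uT.
by move=> i; rewrite weight_mul // mulf_neq0.
Qed.

Lemma act_mul T S M : regular_at S M -> regular_at T (act S M) ->
  act (T *m S) M = act T (act S M).
Proof.
move=> rS rT; have rTS := regular_mul rS rT.
have [[uS wS] [uT wT]] := (rS, rT).
apply: config_eq => i.
  rewrite !point_act // weight_mul // -scalemxAr scalerA mulmxA; congr (_ *: _).
  by rewrite invfM.
rewrite !line_act // weight_mul // -scalemxAl scalerA -mulmxA; congr (_ *: (_ *m _)).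
exact: (@invrM 'M[E]_3 T S uT uS).
Qed.

Lemma act1 M : regular_at 1%:M M /\ act 1%:M M = M.
Proof.
have w1 i : weight 1%:M M i = 1 by rewrite weightE mul1mx mxE.
have r1 : regular_at 1%:M M.
  by split=> [|i]; rewrite ?unitmx1 // w1 oner_neq0.
split=> //; apply: config_eq => i.
  by rewrite point_act // w1 invr1 scale1r mul1mx.
by rewrite line_act // w1 scale1r invmx1 mulmx1.
Qed.

Lemma regular_inv T M : regular_at T M -> regular_at (invmx T) (act T M).
Proof.
move=> rT; have [uT w0] := rT; split; first by rewrite unitmx_inv.
move=> i; have := weight_mul (invmx T) i rT; rewrite mulVmx // => e.
apply: contraTneq (oner_neq0 E) => h; rewrite -(_ : weight 1%:M M i = 1).
  by rewrite e h mul0r eqxx.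
by rewrite weightE mul1mx mxE.
Qed.

Lemma act_invK T M : regular_at T M -> act (invmx T) (act T M) = M.
Proof.
move=> rT; have [uT _] := rT.
by rewrite -act_mul ?mulVmx ?(act1 M).2 //; apply: regular_inv.
Qed.

End Configurations.

(** * Density of the real matrices *)

Section LinePolynomials.

Variables (K : fieldType) (V : lmodType K).
Implicit Types (f g : V -> K).

(** Restricting to lines avoids polynomials in several variables: stability
    under ring operations is immediate, and a matrix can be changed one
    entry at a time by moving along a line. *)
Definition line_poly f :=
  forall a b, exists p : {poly K}, forall t, f (a + t *: b) = p.[t].

Lemma line_polyC c : line_poly (fun=> c).
Proof. by move=> a b; exists c%:P => t; rewrite hornerC. Qed.

Lemma line_polyD f g :
  line_poly f -> line_poly g -> line_poly (fun A => f A + g A).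
Proof.
move=> hf hg a b; have [[p hp] [q hq]] := (hf a b, hg a b).
by exists (p + q) => t; rewrite hornerD hp hq.
Qed.

Lemma line_polyM f g :
  line_poly f -> line_poly g -> line_poly (fun A => f A * g A).
Proof.
move=> hf hg a b; have [[p hp] [q hq]] := (hf a b, hg a b).
by exists (p * q) => t; rewrite hornerM hp hq.
Qed.

Lemma line_poly_sum (I : Type) (r : seq I) (P : pred I) (F : I -> V -> K) :
  (forall i, line_poly (F i)) -> line_poly (fun A => \sum_(i <- r | P i) F i A).
Proof.
move=> hF a b; elim: r => [|i r [p hp]].
  by exists 0 => t; rewrite big_nil horner0.
have [q hq] := hF i a b; exists ((if P i then q else 0) + p) => t.
rewrite big_cons hornerD -hp; case: ifP => _; first by rewrite hq.
by rewrite horner0 add0r.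
Qed.

Lemma line_poly_prod (I : Type) (r : seq I) (P : pred I) (F : I -> V -> K) :
  (forall i, line_poly (F i)) -> line_poly (fun A => \prod_(i <- r | P i) F i A).
Proof.
move=> hF a b; elim: r => [|i r [p hp]].
  by exists 1 => t; rewrite big_nil hornerC.
have [q hq] := hF i a b; exists ((if P i then q else 1) * p) => t.
rewrite big_cons hornerM -hp; case: ifP => _; first by rewrite hq.
by rewrite hornerC mul1r.
Qed.

Lemma line_poly_det m (F : V -> 'M[K]_m) :
  (forall i j, line_poly (fun A => F A i j)) -> line_poly (fun A => \det (F A)).
Proof.
move=> hF; apply: line_poly_sum => s; apply: line_polyM.
  exact: line_polyC.
exact: line_poly_prod.
Qed.

Lemma line_poly_adj m (F : V -> 'M[K]_m) i j :
  (forall i j, line_poly (fun A => F A i j)) ->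
  line_poly (fun A => (\adj (F A)) i j).
Proof.
move=> hF; have : line_poly (fun A => cofactor (F A) j i).
  apply: line_polyM; first exact: line_polyC.
  apply: (@line_poly_det _ (fun A => row' j (col' i (F A)))) => k l a b.
  by have [p hp] := hF (lift j k) (lift i l) a b; exists p => t; rewrite !mxE.
by move=> h a b; have [p hp] := h a b; exists p => t; rewrite mxE.
Qed.

Definition rational_on (U : V -> Prop) f := exists p q,
  [/\ line_poly p, line_poly q & forall A, U A -> q A != 0 /\ f A = p A / q A].

Variable U : V -> Prop.

Lemma rational_on_ext f g : (forall A, U A -> f A = g A) ->
  rational_on U f -> rational_on U g.
Proof.
move=> fg [p [q [hp hq h]]]; exists p, q; split=> // A uA.
by rewrite -fg //; apply: h.
Qed.

Lemma rational_on_poly f : line_poly f -> rational_on U f.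
Proof.
move=> hf; exists f, (fun=> 1); split=> // [|A _]; first exact: line_polyC.
by rewrite oner_neq0 divr1.
Qed.

Lemma rational_onD f g :
  rational_on U f -> rational_on U g -> rational_on U (fun A => f A + g A).
Proof.
move=> [p [q [hp hq h]]] [p' [q' [hp' hq' h']]].
exists (fun A => p A * q' A + p' A * q A), (fun A => q A * q' A); split.
- by apply: line_polyD; apply: line_polyM.
- exact: line_polyM.
- move=> A uA; have [[q0 ->] [q'0 ->]] := (h A uA, h' A uA).
  by rewrite mulf_neq0 // addf_div.
Qed.

Lemma rational_onM f g :
  rational_on U f -> rational_on U g -> rational_on U (fun A => f A * g A).
Proof.
move=> [p [q [hp hq h]]] [p' [q' [hp' hq' h']]].
exists (fun A => p A * p' A), (fun A => q A * q' A); split.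
- exact: line_polyM.
- exact: line_polyM.
- move=> A uA; have [[q0 ->] [q'0 ->]] := (h A uA, h' A uA).
  by rewrite mulf_neq0 // mulf_div.
Qed.

Lemma rational_onV f : (forall A, U A -> f A != 0) -> line_poly f ->
  rational_on U (fun A => (f A)^-1).
Proof.
move=> f0 hf; exists (fun=> 1), f; split=> // [|A /f0 -> //].
  exact: line_polyC.
by rewrite div1r.
Qed.

Lemma rational_on_mmap (R : realType) m (phi : {rmorphism R -> K})
    (h : V -> 'I_m -> K) (P : {mpoly R[m]}) :
  (forall i, rational_on U (fun A => h A i)) ->
  rational_on U (fun A => mmap phi (h A) P).
Proof.
have hC c : rational_on U (fun=> c) by apply/rational_on_poly/line_polyC.
move=> hh; elim/mpolyind: P => [|a mm P _ _ IH].
  by apply: (rational_on_ext _ (hC 0)) => A _; rewrite rmorph0.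
have hm : rational_on U (fun A => mmap1 (h A) mm).
  rewrite /mmap1; elim: (index_enum _) => [|i r IHr].
    by apply: (rational_on_ext _ (hC 1)) => A _; rewrite big_nil.
  have hi : rational_on U (fun A => h A i ^+ mm i).
    elim: (mm i) => [|j IHj]; first exact: hC.
    by apply: (rational_on_ext _ (rational_onM (hh i) IHj)) => A _; rewrite exprS.
  by apply: (rational_on_ext _ (rational_onM hi IHr)) => A _; rewrite big_cons.
apply: (rational_on_ext _ (rational_onD (rational_onM (hC (phi a)) hm) IH)) => A _.
by rewrite rmorphD /= mmapZ mmapX.
Qed.

End LinePolynomials.

Lemma line_poly_entry (K : fieldType) m n (i : 'I_m) (j : 'I_n) :
  line_poly (fun A : 'M[K]_(m, n) => A i j).
Proof.
move=> A B; exists ((A i j)%:P + (B i j)%:P * 'X) => t.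
by rewrite !mxE hornerD hornerM !hornerC hornerX mulrC.
Qed.

Section Density.

Variables (R : realType) (K : fieldType) (phi : {rmorphism R -> K}) (m n : nat).
Implicit Types (f : 'M[K]_(m, n) -> K).

Lemma poly_vanish (p : {poly K}) : (forall t : R, p.[phi t] = 0) -> p = 0.
Proof.
move=> hp; apply: (@roots_geq_poly_eq0 _ _ [seq phi i%:R | i <- iota 0 (size p)]).
- by apply/allP => _ /mapP[i _ ->]; apply/rootP.
- rewrite map_inj_uniq ?iota_uniq // => i j /fmorph_inj /eqP.
  by rewrite Num.Theory.eqr_nat => /eqP.
- by rewrite size_map size_iota.
Qed.

(** The entries of A are made arbitrary one after the other: on the line where
    only one entry varies, f is a polynomial with all real numbers as roots. *)
Lemma line_poly_vanish f : line_poly f ->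
  (forall A : 'M[R]_(m, n), f (map_mx phi A) = 0) -> forall A, f A = 0.
Proof.
move=> hf f0 A.
suff H (s : seq ('I_m * 'I_n)) (B : 'M[R]_(m, n)) :
    f (map_mx phi B + \sum_(e <- s) A e.1 e.2 *: delta_mx e.1 e.2) = 0.
  have := H (index_enum _) 0; rewrite map_mx0 add0r.
  by rewrite [X in f X](_ : _ = A) // [RHS]matrix_sum_delta pair_big.
elim: s B => [|e s IH] B; first by rewrite big_nil addr0.
set S := \sum_(e <- s) _ in IH.
have [p hp] := hf (map_mx phi B + S) (delta_mx e.1 e.2).
rewrite big_cons addrCA addrC -/S hp.
suff -> : p = 0 by rewrite horner0.
apply: poly_vanish => t; rewrite -hp -(IH (B + t *: delta_mx e.1 e.2)).
by rewrite map_mxD map_mxZ map_delta_mx addrAC.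
Qed.

(** The product of the numerator of f and of d, which cuts out the complement of
    U, vanishes at every real matrix, whether or not it belongs to U. *)
Lemma rational_on_vanish (U : 'M[K]_(m, n) -> Prop) (d f : 'M[K]_(m, n) -> K) :
  line_poly d -> (forall A, U A <-> d A != 0) -> rational_on U f ->
  (forall A : 'M[R]_(m, n), U (map_mx phi A) -> f (map_mx phi A) = 0) ->
  forall A, U A -> f A = 0.
Proof.
move=> hd Ud [p [q [hp hq h]]] f0 A uA.
have [_ ->] := h A uA; have d0 : d A != 0 by apply/Ud.
suff /eqP : p A * d A = 0.
  by rewrite mulf_eq0 (negPf d0) orbF => /eqP ->; rewrite mul0r.
apply: (@line_poly_vanish (fun A => p A * d A)); first exact: line_polyM.
move=> B; have [->|dB] := eqVneq (d (map_mx phi B)) 0; first by rewrite mulr0.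
have uB : U (map_mx phi B) by apply/Ud.
have [q0 e] := h _ uB; move/eqP: (f0 _ uB).
by rewrite e mulf_eq0 invr_eq0 (negPf q0) orbF => /eqP ->; rewrite mul0r.
Qed.

End Density.

Section ActionIsRational.

Variables (K : fieldType) (n : nat) (M : 'M[K]_(n, 4)).

Lemma line_poly_weight i : line_poly (fun T => weight T M i).
Proof.
apply: line_polyD; last exact: line_poly_entry.
by apply: line_polyD; apply: line_polyM;
  [exact: line_poly_entry | exact: line_polyC
  |exact: line_poly_entry | exact: line_polyC].
Qed.

Lemma rational_on_act i c :
  rational_on (fun T => regular_at T M) (fun T => act T M i c).
Proof.
have hw := line_poly_weight i.
have hX r : line_poly (fun T : 'M[K]_3 => (T *m point M i) r 0).
  have : line_poly (fun T : 'M[K]_3 => \sum_s T r s * point M i s 0).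
    by apply: line_poly_sum => s; apply: line_polyM;
      [exact: line_poly_entry | exact: line_polyC].
  by move=> h a b; have [p hp] := h a b; exists p => t; rewrite mxE.
have hx r : rational_on (fun T => regular_at T M)
    (fun T => (T *m point M i) r 0 / weight T M i).
  apply: rational_onM; first exact: rational_on_poly.
  by apply: rational_onV hw => T [].
have hp s : rational_on (fun T => regular_at T M)
    (fun T => weight T M i * (line M i *m invmx T) 0 s).
  apply: rational_onM; first exact: rational_on_poly.
  have h r : line_poly (fun T : 'M[K]_3 => line M i 0 r * (\adj T) r s).
    apply: line_polyM; first exact: line_polyC.
    exact/line_poly_adj/line_poly_entry.
  have := @rational_on_poly _ _ (fun T => regular_at T M) _
    (line_poly_sum (index_enum _) xpredT h).
  have hd : rational_on (fun T : 'M[K]_3 => regular_at T M)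
      (fun T => (\det T)^-1).
    apply: rational_onV => [T [uT _]|]; first by rewrite -unitfE -unitmxE.
    exact/line_poly_det/line_poly_entry.
  move=> /rational_onM /(_ hd); apply: rational_on_ext => T [uT _].
  rewrite mxE mulr_suml; apply: eq_bigr => r _.
  by rewrite /invmx uT -mulrA; congr (_ * _); rewrite [RHS]mxE mulrC.
have : rational_on (fun T => regular_at T M) (fun T =>
    [:: (T *m point M i) 0 0 / weight T M i;
        (T *m point M i) 1 0 / weight T M i;
        weight T M i * (line M i *m invmx T) 0 0;
        weight T M i * (line M i *m invmx T) 0 1]`_c).
  case: c => -[|[|[|[|//]]]] /= _; [exact: hx | exact: hx | exact: hp | exact: hp].
by apply: rational_on_ext => T _; rewrite [RHS]mxE.
Qed.

(** The polynomial that cuts out the matrices that are not regular at M is the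
    product of the determinant and of all the weights. *)
Lemma act_vanish (R : realType) (phi : {rmorphism R -> K}) (f : 'M[K]_3 -> K) :
  rational_on (fun T => regular_at T M) f ->
  (forall A, regular_at (map_mx phi A) M -> f (map_mx phi A) = 0) ->
  forall T, regular_at T M -> f T = 0.
Proof.
apply: (@rational_on_vanish R K phi 3 3 _ (fun T => \det T * \prod_i weight T M i)).
  apply: line_polyM; first exact/line_poly_det/line_poly_entry.
  exact/line_poly_prod/line_poly_weight.
move=> T; rewrite mulf_eq0 negb_or -unitfE -unitmxE.
split=> [[-> h]|/andP[uT /prodf_neq0 h]]; last by split=> // i; apply: h.
by apply/prodf_neq0 => i _; apply: h.
Qed.

End ActionIsRational.

(** * The generators on configurations *)

Lemma nth_flatten_map (I T : Type) (x0 : T) (k0 : I) (d : nat)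
    (q : I -> seq T) (ks : seq I) (m c : nat) :
  (forall k, size (q k) = d) -> (c < d)%N -> (m < size ks)%N ->
  nth x0 (flatten [seq q k | k <- ks]) (d * m + c) = nth x0 (q (nth k0 ks m)) c.
Proof.
move=> sq cd; elim: ks m => [//|k ks IH] [|m] lt /=.
  by rewrite muln0 add0n nth_cat sq cd.
by rewrite nth_cat sq mulnS -addnA ltnNge leq_addr /= addKn IH.
Qed.

Lemma ord4_ind (P : 'I_4 -> Prop) : P 0 -> P 1 -> P 2 -> P 3 -> forall c, P c.
Proof.
move=> h0 h1 h2 h3 -[[|[|[|[|//]]]] lt].
- by rewrite (_ : Ordinal lt = 0) //; apply: val_inj.
- by rewrite (_ : Ordinal lt = 1) //; apply: val_inj.
- by rewrite (_ : Ordinal lt = 2) //; apply: val_inj.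
- by rewrite (_ : Ordinal lt = 3) //; apply: val_inj.
Qed.

Section InvariantsOfConfigurations.

Variables (n : nat) (hn : (4 <= n)%N).

Definition p1 : 'I_n := widen_ord hn 0.
Definition p2 : 'I_n := widen_ord hn 1.
Definition p3 : 'I_n := widen_ord hn 2.
Definition others : seq 'I_n := [seq k : 'I_n <- enum 'I_n | (3 <= k)%N].

Lemma val_others : map (@nat_of_ord n) others = iota 3 (n - 3).
Proof.
have -> : map (@nat_of_ord n) others =
    [seq m <- map (@nat_of_ord n) (enum 'I_n) | (3 <= m)%N] by rewrite filter_map.
rewrite val_enum_ord -[X in iota 0 X](subnKC (ltnW hn)) iotaD filter_cat /=.
by apply/all_filterP/allP => k; rewrite mem_iota => /andP[].
Qed.

Lemma size_others : size others = (n - 3)%N.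
Proof. by rewrite -(size_map (@nat_of_ord n)) val_others size_iota. Qed.

Lemma nth_others (k : 'I_n) : (3 <= k)%N -> nth p1 others (k - 3) = k.
Proof.
move=> k3; have kn := ltn_ord k; have lt : (k - 3 < n - 3)%N by lia.
apply: val_inj; rewrite /= -(nth_map _ 0%N (@nat_of_ord n)) ?size_others //.
by rewrite val_others nth_iota // subnKC.
Qed.

Lemma point_cases (i : 'I_n) : [\/ i = p1, i = p2, i = p3 | (3 <= i)%N].
Proof.
case: i => -[|[|[|i]]] lt.
- by constructor 1; apply: val_inj.
- by constructor 2; apply: val_inj.
- by constructor 3; apply: val_inj.
- by constructor 4.
Qed.

Variable E : fieldType.
Implicit Types (M : 'M[E]_(n, 4)) (k : 'I_n) (s : nat -> E).

(** zeta_12, zeta_13, zeta_23 and tau; the signs come from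
    Phi^(j)_ij = - inc j i. *)
Definition inv_base M : seq E :=
  [:: - (inc M p1 p2 * inc M p2 p1); - (inc M p1 p3 * inc M p3 p1);
      - (inc M p2 p3 * inc M p3 p2); inc M p1 p3 * inc M p3 p2 * inc M p2 p1].

(** The denominator of xi_4 up to inc M p1 p3; on the normalized configurations
    it is the coordinate p_k. *)
Definition skew M k : E := inc M k p2 - inc M p1 p2 * inc M k p1.

(** xi_1, ..., xi_4.  The numerator of xi_4 is the intersection of the lines of
    jets 1 and k paired with the line through points 2 and 3; expanded along
    this pairing it becomes a determinant of incidences. *)
Definition inv_other M k : seq E :=
  [:: area M p1 p2 p3 * inc M p1 k / area M p2 p3 k;
      area M p1 p2 k * inc M p1 p3 / area M p2 p3 k;
      (area M p2 p3 k + area M p1 p2 p3 * inc M p1 k) * skew M k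
        / (area M p1 p2 p3 * inc M p1 p2);
      (inc M p1 p2 * inc M k p3 - inc M p1 p3 * inc M k p2)
        / (inc M p1 p3 * skew M k)].

Definition invs M : seq E :=
  inv_base M ++ flatten [seq inv_other M k | k <- others].

Lemma size_invs M : size (invs M) = (4 * n - 8)%N.
Proof.
have h ks : size (flatten [seq inv_other M k | k <- ks]) = (4 * size ks)%N.
  by elim: ks => //= k ks ->; rewrite mulnS.
by rewrite size_cat h size_others /=; lia.
Qed.

Lemma nth_invs M k c : (3 <= k)%N -> (c < 4)%N ->
  (invs M)`_(4 + (4 * (k - 3) + c)) = (inv_other M k)`_c.
Proof.
move=> k3 c4; have kn := ltn_ord k; rewrite nth_cat ltnNge leq_addr addKn.
rewrite (@nth_flatten_map _ _ 0 p1 4) ?nth_others // size_others; lia.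
Qed.

(** Positions in the list of invariants: four for the first three jets, then
    four for each further one. *)
Lemma inv_index (P : nat -> Prop) : (forall j, (j < 4)%N -> P j) ->
  (forall (k : 'I_n) c, (3 <= k)%N -> (c < 4)%N ->
    P (4 + (4 * (k - 3) + c))%N) ->
  forall j, (j < 4 * n - 8)%N -> P j.
Proof.
move=> h1 h2 j jn; have [/h1//|j4] := ltnP j 4.
have mn : ((j - 4) %/ 4 + 3 < n)%N by lia.
have c4 : ((j - 4) %% 4 < 4)%N by apply: ltn_pmod.
have := h2 (Ordinal mn) ((j - 4) %% 4)%N (leq_addl _ _) c4.
by rewrite /= addnK mulnC -divn_eq subnKC.
Qed.

(** Besides the denominators of the generators, this excludes the configurations
    that the moving frame sends to infinity or that cannot be recovered from
    their invariants. *)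
Definition nondegenerate M : Prop :=
  [/\ area M p1 p2 p3 != 0, inc M p1 p2 != 0, inc M p1 p3 != 0,
      inc M p2 p1 != 0 & inc M p3 p2 != 0] /\
  forall k, (3 <= k)%N -> [/\ area M p2 p3 k != 0,
    area M p2 p3 k + area M p1 p2 p3 * inc M p1 k != 0 & skew M k != 0].

Lemma skew_act T M k : regular_at T M ->
  skew (act T M) k = weight T M k / weight T M p2 * skew M k.
Proof.
by move=> rT; have [_ w0] := rT; rewrite /skew !inc_act //; field; rewrite !w0.
Qed.

Lemma pivot_act T M k : regular_at T M ->
  area (act T M) p2 p3 k + area (act T M) p1 p2 p3 * inc (act T M) p1 k =
  \det T / (weight T M p2 * weight T M p3 * weight T M k)
    * (area M p2 p3 k + area M p1 p2 p3 * inc M p1 k).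
Proof.
move=> rT; have [_ w0] := rT; rewrite !area_act // inc_act //.
by field; rewrite !w0.
Qed.

Lemma nondegenerate_act T M :
  regular_at T M -> nondegenerate M -> nondegenerate (act T M).
Proof.
move=> rT [[a i12 i13 i21 i32] h]; have [uT w0] := rT.
have d0 : \det T != 0 by rewrite -unitfE -unitmxE.
split=> [|k k3].
  by rewrite !area_act // !inc_act // !(mulf_neq0, invr_neq0).
have [h1 h2 h3] := h k k3.
by rewrite pivot_act // area_act // skew_act // !(mulf_neq0, invr_neq0).
Qed.

Lemma inv_other_act T M k : regular_at T M -> nondegenerate M -> (3 <= k)%N ->
  inv_other (act T M) k = inv_other M k.
Proof.
move=> rT [[a i12 i13 i21 i32] h] k3; have [uT w0] := rT.
have d0 : \det T != 0 by rewrite -unitfE -unitmxE.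
have [h1 h2 h3] := h k k3.
rewrite /inv_other pivot_act // skew_act // !area_act // !inc_act //.
by congr [:: _; _; _; _]; field; rewrite !(w0, h1, h2, h3, a, i12, i13, d0).
Qed.

Lemma invs_act T M : regular_at T M -> nondegenerate M -> invs (act T M) = invs M.
Proof.
move=> rT nM; have [uT w0] := rT; congr (_ ++ flatten _).
  rewrite /inv_base !inc_act //.
  by congr [:: _; _; _; _]; field; rewrite !w0.
by apply/eq_in_map => k; rewrite mem_filter => /andP[k3 _]; apply: inv_other_act.
Qed.

(** The normalized configuration with invariants s 0, s 1, and so on.
    Normalizing the first jet and points 2 and 3 gives incidences inc p1 p2
    = inc p1 p3 = 1 and area 1, after which the equations for the remaining
    coordinates can be solved one by one. *)
Definition cross_section s : 'M[E]_(n, 4) := \matrix_(i, c)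
  (match nat_of_ord i with
   | 0%N => [:: 0; 0; 1; 1]
   | 1%N => [:: -1; 0; s 0; s 0 + s 0 * s 2 / s 3]
   | 2%N => [:: 0; -1; s 1 - s 3 / s 0; s 1]
   | k.+3 => let a := (4 + 4 * k)%N in
     [:: (s a.+1 - s a) / (1 + s a); - s a.+1 / (1 + s a);
         s a.+2; s a.+2 * (1 + s a.+3)]
   end)`_c.

Lemma cross_section_index k c :
  (4 + (4 * (k - 3) + c) = c + (4 + 4 * (k - 3)))%N.
Proof. by rewrite addnA addnC. Qed.

Lemma cross_sectionE s (M := cross_section s) :
  (forall c, M p1 c = [:: 0; 0; 1; 1]`_c) *
  (forall c, M p2 c = [:: -1; 0; s 0 ; s 0 + s 0 * s 2 / s 3]`_c) *
  (forall c, M p3 c = [:: 0; -1; s 1 - s 3 / s 0; s 1]`_c) *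
  (forall k c, (3 <= k)%N -> let a := (4 + 4 * (k - 3))%N in
     M k c = [:: (s a.+1 - s a) / (1 + s a); - s a.+1 / (1 + s a);
         s a.+2; s a.+2 * (1 + s a.+3)]`_c).
Proof.
do !split; try by move=> c; rewrite mxE.
by case=> -[|[|[|k]]] lt c //= _; rewrite mxE /= subSS subSS subSS subn0.
Qed.

Section CrossSectionInvariants.

Variable s : nat -> E.
Hypothesis s0 : forall j, s j != 0.
Hypothesis s1 : forall j, 1 + s j != 0.

Lemma cross_section_base :
  (area (cross_section s) p1 p2 p3 = 1) * (inc (cross_section s) p1 p2 = 1) *
  (inc (cross_section s) p1 p3 = 1) * (inc (cross_section s) p2 p1 = - s 0) *
  (inc (cross_section s) p3 p1 = - s 1) *
  (inc (cross_section s) p3 p2 = - (s 3 / s 0)) *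
  (inc (cross_section s) p2 p3 = s 0 * s 2 / s 3).
Proof.
have [h0 h3] := (s0 0, s0 3).
by rewrite /area /inc !cross_sectionE /=; do !split; try ring; field; rewrite ?h0 ?h3.
Qed.

Lemma cross_section_other k (a := (4 + 4 * (k - 3))%N) : (3 <= k)%N ->
  (area (cross_section s) p2 p3 k = (1 + s a)^-1) *
  (area (cross_section s) p1 p2 k = s a.+1 / (1 + s a)) *
  (inc (cross_section s) p1 k = s a / (1 + s a)) *
  (skew (cross_section s) k = s a.+2) *
  (inc (cross_section s) k p3 - inc (cross_section s) k p2 = s a.+2 * s a.+3).
Proof.
move=> k3; rewrite /skew cross_section_base /area /inc !cross_sectionE // -/a /=.
by have h := s1 a; do !split; field.
Qed.

Lemma cross_section_pivot k : (3 <= k)%N -> area (cross_section s) p2 p3 k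
  + area (cross_section s) p1 p2 p3 * inc (cross_section s) p1 k = 1.
Proof.
move=> k3; rewrite cross_section_base !cross_section_other //.
by have h := s1 (4 + 4 * (k - 3)); field.
Qed.

Lemma cross_section_nondegenerate : nondegenerate (cross_section s).
Proof.
have o0 := oner_neq0 E.
split=> [|k k3].
  by rewrite !cross_section_base o0 !oppr_eq0 !(mulf_neq0, invr_neq0) ?s0.
by rewrite cross_section_pivot // !cross_section_other // invr_neq0.
Qed.

Lemma invs_cross_section j : (j < 4 * n - 8)%N ->
  (invs (cross_section s))`_j = s j.
Proof.
apply: (@inv_index (fun j => (invs (cross_section s))`_j = s j)) => [{}j|k c k3 c4].
  move=> j4; rewrite nth_cat j4; have [h0 h3] := (s0 0, s0 3).
  rewrite /inv_base !cross_section_base.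
  by case: j j4 => [|[|[|[|//]]]] _ /=; field; rewrite ?h0 ?h3.
rewrite nth_invs // cross_section_index /inv_other cross_section_pivot //.
rewrite !cross_section_base !mul1r !cross_section_other //; set a := (4 + _)%N.
have [h2 h] := (s0 a.+2, s1 a).
by case: c c4 => [|[|[|[|//]]]] _ /=; rewrite ?addSn ?add0n;
  field; rewrite ?h ?h2 ?oner_neq0.
Qed.

End CrossSectionInvariants.

Definition normalized M : Prop :=
  [/\ M p1 0 = 0, M p1 1 = 0, M p1 2 = 1 & M p1 3 = 1] /\
  [/\ M p2 0 = -1, M p2 1 = 0, M p3 0 = 0 & M p3 1 = -1].

(** On normalized configurations xi_1 = - (x_k + y_k) / (1 + x_k + y_k) and
    xi_2 = - y_k / (1 + x_k + y_k), so that 1 + xi_1 = 1 / (1 + x_k + y_k) gives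
    access to x_k and y_k; moreover xi_3 = p_k and xi_4 = (q_k - p_k) / p_k. *)
Lemma normalizedE M : normalized M -> nondegenerate M ->
  M = cross_section (fun j => (invs M)`_j).
Proof.
move=> [[x1 y1 u1 v1] [x2 y2 x3 y3]] [[_ _ _ i21 i32] nk].
set s := fun j => _.
have a123 : area M p1 p2 p3 = 1 by rewrite /area x1 y1 x2 y2 x3 y3; ring.
have i12 : inc M p1 p2 = 1 by rewrite /inc x1 y1 u1 v1 x2 y2; ring.
have i13 : inc M p1 p3 = 1 by rewrite /inc x1 y1 u1 v1 x3 y3; ring.
have e21 : inc M p2 p1 = - M p2 2 by rewrite /inc x1 y1 x2 y2; ring.
have e31 : inc M p3 p1 = - M p3 3 by rewrite /inc x1 y1 x3 y3; ring.
have e32 : inc M p3 p2 = M p3 2 - M p3 3 by rewrite /inc x2 y2 x3 y3; ring.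
have e23 : inc M p2 p3 = M p2 3 - M p2 2 by rewrite /inc x2 y2 x3 y3; ring.
move: i21 i32; rewrite e21 e32 oppr_eq0 => n21 n32.
have sE : [/\ s 0 = M p2 2, s 1 = M p3 3,
    s 2 = (M p2 3 - M p2 2) * (M p3 3 - M p3 2)
    & s 3 = (M p3 3 - M p3 2) * M p2 2].
  by rewrite /s /= i12 i13 e21 e31 e32 e23; split; ring.
case: sE => sE0 sE1 sE2 sE3.
apply/matrixP => i c; move: c.
case: (point_cases i) => [->|->|->|k3]; apply: ord4_ind; rewrite cross_sectionE //=.
- by rewrite sE0 sE2 sE3; field; rewrite n21 -opprB oppr_eq0 n32.
- by rewrite sE1 sE0 sE3; field.
all: have [] := nk i k3; rewrite a123 mul1r /skew i12 mul1r.
all: set a := (4 + _)%N.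
all: have sc d : (d < 4)%N -> s (d + a)%N = (inv_other M i)`_d by
  move=> d4; rewrite -cross_section_index /s nth_invs.
all: have := (sc 0%N isT, sc 1%N isT, sc 2%N isT, sc 3%N isT);
  rewrite /= ?addSn ?add0n /skew a123 i12 i13 !mul1r !mulr1 => -[[[e0 e1] e2] e3];
  rewrite ?e0 ?e1 ?e2 ?e3.
all: rewrite /area /inc x1 y1 u1 v1 x2 y2 x3 y3.
all: move=> h1 h2 h3; field; rewrite ?oner_neq0 ?andbT //.
all: have nz (u v : E) : u = v -> v != 0 -> u != 0 by move->.
all: by do ?[apply/andP; split]; first
  [by apply: nz h1; ring | by apply: nz h2; ring | by apply: nz h3; ring].
Qed.

End InvariantsOfConfigurations.

(** * The moving frame *)

Section MovingFrame.

Variables (E : fieldType) (n : nat) (hn : (4 <= n)%N) (M : 'M[E]_(n, 4)).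
Local Notation p1 := (p1 hn).
Local Notation p2 := (p2 hn).
Local Notation p3 := (p3 hn).
Local Notation x i := (M i 0).
Local Notation y i := (M i 1).
Local Notation d := (area M p1 p2 p3).
Local Notation a := (inc M p1 p2).
Local Notation b := (inc M p1 p3).

(** Row by row, with d = area p1 p2 p3, the three linear forms in a point X are
    - a area(p1, X, p3), - b area(p1, p2, X) and area(X, p2, p3) - d line_1(X).
    So the first point goes to d (0, 0, 1), the second to d a (-1, 0, 1) and the
    third to d b (0, -1, 1).  The weights d a and d b are the ones that turn
    inc p1 p2 and inc p1 p3 into 1; this normalizes the gradient at the first
    point. *)
Definition moving_frame : 'M[E]_3 := \matrix_(r, c)
  (nth [::] [::
    [:: a * (y p1 - y p3); - a * (x p1 - x p3); a * (x p1 * y p3 - x p3 * y p1)];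
    [:: - b * (y p1 - y p2); b * (x p1 - x p2); - b * (x p1 * y p2 - x p2 * y p1)];
    [:: y p2 - y p3 - d * M p1 2; x p3 - x p2 - d * M p1 3;
        x p2 * y p3 - x p3 * y p2 + d * (x p1 * M p1 2 + y p1 * M p1 3)]] r)`_c.

Lemma weight_frame k :
  weight moving_frame M k = area M p2 p3 k + d * inc M p1 k.
Proof. by rewrite /weight !mxE /= /area /inc; ring. Qed.

Lemma weight_frame_base :
  (weight moving_frame M p1 = d) * (weight moving_frame M p2 = d * a) *
  (weight moving_frame M p3 = d * b).
Proof. by rewrite !weight_frame /area /inc; do !split; ring. Qed.

Lemma det_frame : \det moving_frame = d ^+ 2 * a * b.
Proof. by rewrite det3E !mxE /= /area /inc; ring. Qed.

Hypothesis nM : nondegenerate hn M.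

Lemma frame_regular : regular_at moving_frame M.
Proof.
have [[d0 a0 b0 _ _] h] := nM; split.
  by rewrite unitmxE unitfE det_frame !(mulf_neq0, expf_neq0).
move=> i; case: (point_cases hn i) => [->|->|->|/h[_ h2 _]].
- by rewrite weight_frame_base.
- by rewrite weight_frame_base mulf_neq0.
- by rewrite weight_frame_base mulf_neq0.
- by rewrite weight_frame.
Qed.

Lemma frame_normalized : normalized hn (act moving_frame M).
Proof.
have rT := frame_regular; have [[d0 a0 b0 _ _] h] := nM.
have X i :
    (act moving_frame M i 0 =
       (moving_frame *m point M i) 0 0 / weight moving_frame M i) *
    (act moving_frame M i 1 =
       (moving_frame *m point M i) 1 0 / weight moving_frame M i).
  by rewrite ![act _ _ _ _]mxE.
have zero (u v : E) : u = 0 -> u / v = 0 by move->; rewrite mul0r.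
have x1 : act moving_frame M p1 0 = 0.
  by rewrite X; apply: zero; rewrite mxE sum3 !mxE /=; ring.
have y1 : act moving_frame M p1 1 = 0.
  by rewrite X; apply: zero; rewrite mxE sum3 !mxE /=; ring.
have x2 : act moving_frame M p2 0 = -1.
  apply: (mulIf (mulf_neq0 d0 a0)); rewrite X weight_frame_base.
  by rewrite divfK ?mulf_neq0 // mxE sum3 !mxE /= {1}/area; ring.
have y2 : act moving_frame M p2 1 = 0.
  by rewrite X; apply: zero; rewrite mxE sum3 !mxE /=; ring.
have x3 : act moving_frame M p3 0 = 0.
  by rewrite X; apply: zero; rewrite mxE sum3 !mxE /=; ring.
have y3 : act moving_frame M p3 1 = -1.
  apply: (mulIf (mulf_neq0 d0 b0)); rewrite X weight_frame_base.
  by rewrite divfK ?mulf_neq0 // mxE sum3 !mxE /= {1}/area; ring.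
(* the gradient at the first point is read off the incidences 1-2 and 1-3 *)
have := (inc_act p1 p2 rT, inc_act p1 p3 rT); rewrite !weight_frame_base.
rewrite !{1}/(inc (act _ _)) /inc x1 y1 x2 y2 x3 y3 => -[e2 e3].
do !split => //.
- transitivity (d / (d * a) * a); last by field; rewrite d0 a0.
  by rewrite -e2; ring.
- transitivity (d / (d * b) * b); last by field; rewrite d0 b0.
  by rewrite -e3; ring.
Qed.

End MovingFrame.

(** * The generic configuration *)

(** The chain rule at one point, with t_r the r-th entry in a column of T, h and
    w the homogeneous coordinates of the image point and (l0, l1, l2) the
    image line; l2 is eliminated by the incidence l0 h0 + l1 h1 + l2 w = 0. *)
Lemma gradient_eq (F : fieldType) (l0 l1 t0 t1 t2 h0 h1 w : F) : w != 0 ->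
  l0 * t0 + l1 * t1 + - (l0 * h0 + l1 * h1) / w * t2 =
  w * l0 * ((t0 * w - h0 * t2) / w ^+ 2) + w * l1 * ((t1 * w - h1 * t2) / w ^+ 2).
Proof. by move=> w0; field. Qed.

Section GenericConfiguration.

Variables (R : realType) (n : nat).
Local Notation K := {ratfun R[n * 4]}.
Local Notation C := (ratC (n * 4)).
Local Notation X := (generic_config R n).

Lemma mxvec_generic i : mxvec X 0 i = ratX R i.
Proof. by case/mxvec_indexP: i => i c; rewrite mxvecE mxE. Qed.

Section ValuesAtConfiguration.

Variables (E : fieldType) (phi : {rmorphism R -> E}) (M : 'M[E]_(n, 4)).
Local Notation value := (has_value phi (mxvec M 0)).

Lemma value_entry i c : value (X i c) (M i c).
Proof. by rewrite mxE -[M i c]mxvecE; apply: has_valueX. Qed.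

Lemma value_inc i j : value (inc X i j) (inc M i j).
Proof.
by apply: has_valueD; apply: has_valueM; do ?apply: has_valueB;
  apply: value_entry.
Qed.

Lemma value_area i j k : value (area X i j k) (area M i j k).
Proof.
apply: has_valueD; first apply: has_valueB.
all: by apply: has_valueM; do ?apply: has_valueB; apply: value_entry.
Qed.

Lemma value_point i r c : value (point X i r c) (point M i r c).
Proof.
rewrite [point X _ _ _]mxE [point M _ _ _]mxE.
case: r => -[|[|[|//]]] /= _; try exact: value_entry.
exact: has_value1.
Qed.

Lemma value_line i r s : value (line X i r s) (line M i r s).
Proof.
rewrite [line X _ _ _]mxE [line M _ _ _]mxE.
case: s => -[|[|[|//]]] /= _; try exact: value_entry.
by apply: has_valueN; apply: has_valueD; apply: has_valueM; apply: value_entry.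
Qed.

Lemma value_mulmx m k l (A : 'M[K]_(m, k)) (B : 'M[K]_(k, l))
    (A' : 'M[E]_(m, k)) (B' : 'M[E]_(k, l)) :
  (forall i j, value (A i j) (A' i j)) -> (forall i j, value (B i j) (B' i j)) ->
  forall i j, value ((A *m B) i j) ((A' *m B') i j).
Proof.
move=> hA hB i j; rewrite !mxE; elim/big_ind2: _ => [|F c G d|s _].
- exact: has_value0.
- exact: has_valueD.
- exact: has_valueM.
Qed.

Lemma value_map (T : 'M[R]_3) i j : value (map_mx C T i j) (map_mx phi T i j).
Proof. by rewrite !mxE; apply: has_valueC. Qed.

Lemma value_act (T : 'M[R]_3) i c : regular_at (map_mx phi T) M ->
  value (act (map_mx C T) X i c) (act (map_mx phi T) M i c).
Proof.
move=> [_ /(_ i) w0].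
have hX := value_mulmx (value_map T) (value_point _).
have hw : value (weight (map_mx C T) X i) (weight (map_mx phi T) M i).
  by rewrite !weightE; apply: hX.
have hL r s : value ((line X i *m invmx (map_mx C T)) r s)
                    ((line M i *m invmx (map_mx phi T)) r s).
  rewrite -!map_invmx; apply: value_mulmx; first exact: value_line.
  exact: value_map.
rewrite [act _ X _ _]mxE [act _ M _ _]mxE.
case: c => -[|[|[|[|//]]]] /= _.
- exact: has_value_div w0 (hX i 0 0) hw.
- exact: has_value_div w0 (hX i 1 0) hw.
- exact: has_valueM hw (hL 0 0).
- exact: has_valueM hw (hL 0 1).
Qed.

Variable hn : (4 <= n)%N.

Lemma value_invs j : nondegenerate hn M -> value (invs hn X)`_j (invs hn M)`_j.
Proof.
move=> [[a i12 i13 i21 i32] h].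
have [jn|jn] := ltnP j (4 * n - 8)%N; last first.
  by rewrite !nth_default ?size_invs //; apply: has_value0.
have hs k : value (skew hn X k) (skew hn M k).
  by apply: has_valueB; last apply: has_valueM; apply: value_inc.
move: j jn; apply: (inv_index hn) => [j j4|k c k3 c4].
  rewrite !nth_cat j4; case: j j4 => [|[|[|[|//]]]] _ /=.
  1-3: by apply: has_valueN; apply: has_valueM; apply: value_inc.
  by apply: has_valueM; first apply: has_valueM; apply: value_inc.
rewrite !nth_invs //; have [h1 h2 h3] := h k k3.
case: c c4 => [|[|[|[|//]]]] _ /=.
- by apply: has_value_div => //; [apply: has_valueM|];
    do ?[apply: value_inc | apply: value_area].
- by apply: has_value_div => //; [apply: has_valueM|];
    do ?[apply: value_inc | apply: value_area].
- apply: has_value_div; first by rewrite mulf_neq0.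
    apply: has_valueM => //; apply: has_valueD; last apply: has_valueM;
    do ?[apply: value_inc | apply: value_area].
  by apply: has_valueM; [apply: value_area | apply: value_inc].
- apply: has_value_div; first by rewrite mulf_neq0.
    by apply: has_valueB; apply: has_valueM; apply: value_inc.
  by apply: has_valueM => //; apply: value_inc.
Qed.

End ValuesAtConfiguration.

(** A polynomial with a nonzero value somewhere is nonzero, and the normalized
    configuration with all invariants equal to 1 is nondegenerate. *)
Lemma generic_nondegenerate (hn : (4 <= n)%N) : nondegenerate hn X.
Proof.
pose M := cross_section n (fun=> 1 : R).
have o2 : 1 + 1 != 0 :> R by rewrite -mulr2n Num.Theory.pnatr_eq0.
have [[a i12 i13 i21 i32] h] : nondegenerate hn M.
  by apply: cross_section_nondegenerate => // _; apply: oner_neq0.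
have va := value_area (idfun : {rmorphism R -> R}) M.
have vi := value_inc (idfun : {rmorphism R -> R}) M.
split=> [|k k3].
  split; [exact: has_value_neq0 (va _ _ _) _ | exact: has_value_neq0 (vi _ _) _
    | exact: has_value_neq0 (vi _ _) _ | exact: has_value_neq0 (vi _ _) _
    | exact: has_value_neq0 (vi _ _) _].
have [h1 h2 h3] := h k k3; split.
- exact: has_value_neq0 (va _ _ _) _.
- by apply: has_value_neq0 h2; apply: has_valueD => //; apply: has_valueM.
- by apply: has_value_neq0 h3; apply: has_valueB => //; apply: has_valueM.
Qed.

Lemma deltaE i j k : delta R i j k = area X i j k.
Proof. by rewrite /delta det3E !mxE /= /area !mxE; ring. Qed.

Lemma PhiE k i j : Phi R k i j = inc X k j - inc X k i.
Proof. by rewrite /Phi /inc; ring. Qed.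

Lemma inc_self k : inc X k k = 0.
Proof. by rewrite /inc; ring. Qed.

Lemma generatorsE (hn : (4 <= n)%N) : generators R hn = invs hn X.
Proof.
have base a b : zeta R a b = - (inc X a b * inc X b a).
  by rewrite /zeta !PhiE !inc_self; ring.
rewrite /generators /invs /inv_base !base /tau !PhiE !inc_self !subr0 !sub0r.
congr (_ ++ flatten _); first by rewrite !mulrN mulNr opprK.
apply: eq_map => k; rewrite /inv_other /xi1 /xi2 /xi3 /xi4 !deltaE.
congr [:: _; _; _; _]; rewrite ?PhiE ?inc_self ?subr0 //.
  by congr (_ * _ / _); rewrite /skew; ring.
congr (_ / (_ * _)); last by rewrite /skew; ring.
by rewrite /area /inc; ring.
Qed.

Section RealAction.

Variable T : 'M[R]_3.
Hypothesis uT : T \in unitmx.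

Lemma hom_coord_point i r : hom_coord T i r = (map_mx C T *m point X i) r 0.
Proof. by rewrite [RHS]mxE sum3 !mxE /= !mulr1 /hom_coord !mxE. Qed.

Lemma real_regular : regular_at (map_mx C T) X.
Proof.
split; first by rewrite map_unitmx.
by move=> i; rewrite weightE -hom_coord_point; apply: hom_coord2_neq0.
Qed.

(** The prolonged action defined by the chain rule is multiplication of the
    lines by the inverse of T: both are solutions of the linear system whose
    matrix is the invertible Jacobian. *)
Lemma proj_configE : proj_config n T = act (map_mx C T) X.
Proof.
have rT := real_regular; have [uCT w0] := rT.
apply/matrixP => i c; rewrite [RHS]mxE [LHS]mxE.
rewrite weightE -!hom_coord_point.
have pE : proj_grad T i = \row_s (hom_coord T i 2 *
    (line X i *m invmx (map_mx C T)) 0 (if s == 0 then 0 else 1)).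
  rewrite /proj_grad -[RHS](mulmxK (proj_jacobian_unit uT i)); congr (_ *m _).
  set L := line X i *m _.
  have lE r :
      line X i 0 r = L 0 0 * C (T 0 r) + L 0 1 * C (T 1 r) + L 0 2 * C (T 2 r).
    by rewrite -[line X i](mulmxKV uCT) [LHS]mxE sum3 ![map_mx C T _ _]mxE.
  have w0i : hom_coord T i 2 != 0 by apply: hom_coord2_neq0.
  have L2 : L 0 2 = - (L 0 0 * hom_coord T i 0 + L 0 1 * hom_coord T i 1)
      / hom_coord T i 2.
    apply: (mulIf w0i); rewrite divfK //; apply/eqP; rewrite -addr_eq0 addrC.
    have : (L *m (map_mx C T *m point X i)) 0 0 = 0.
      by rewrite mulmxA /L (mulmxKV uCT) line_point inc_self oppr0.
    by rewrite [LHS]mxE sum3 -!hom_coord_point => ->.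
  have e1 : lift ord0 ord0 = 1 :> 'I_2 by apply: val_inj.
  have lX0 : X i 2 = line X i 0 0 by rewrite [RHS]mxE.
  have lX1 : X i 3 = line X i 0 1 by rewrite [RHS]mxE.
  apply/rowP => s; rewrite [LHS]mxE [RHS]mxE !big_ord_recl big_ord0 addr0 e1.
  rewrite ![(\row__ _) _ _]mxE ![proj_jacobian _ _ _ _]mxE /= /proj_x /proj_y.
  case: s => -[|[|//]] lt /=; rewrite !ratderiv_hom // ?lX0 ?lX1 lE L2;
    exact: gradient_eq.
by case: c => -[|[|[|[|//]]]] /= _; rewrite // pE mxE.
Qed.

End RealAction.

End GenericConfiguration.

(** * Subfields of rational functions *)

Section DivringClosure.

Variables (R : realType) (N n : nat).
Local Notation K := {ratfun R[N]}.
Local Notation C := (ratC N).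
Variable D : {pred K}.
Hypotheses (dD : GRing.divring_closed D) (CD : forall c : R, C c \in D).

Let mem1 : 1 \in D. Proof. by case: dD. Qed.
Let memB F G : F \in D -> G \in D -> F - G \in D.
Proof. by case: dD => _ h _; apply: h. Qed.
Let mem_div F G : F \in D -> G \in D -> F / G \in D.
Proof. by case: dD => _ _; apply. Qed.
Let mem0 : 0 \in D. Proof. by rewrite -(subrr 1) memB. Qed.
Let memN F : F \in D -> - F \in D.
Proof. by move=> h; rewrite -sub0r memB. Qed.
Let memD F G : F \in D -> G \in D -> F + G \in D.
Proof. by move=> hF hG; rewrite -(opprK G) memB ?memN. Qed.
Let memM F G : F \in D -> G \in D -> F * G \in D.
Proof.
by move=> hF hG; rewrite -(invrK G) mem_div // -(mul1r G^-1) mem_div.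
Qed.

Lemma mem_mmap m (h : 'I_m -> K) (P : {mpoly R[m]}) :
  (forall i, h i \in D) -> mmap C h P \in D.
Proof.
move=> hD; elim/mpolyind: P => [|a mm P _ _ IH]; first by rewrite rmorph0.
rewrite rmorphD /= mmapZ mmapX; apply: memD IH; apply: memM; first exact: CD.
rewrite /mmap1.
apply: (big_ind (fun F : K => F \in D)) => // i _.
elim: (mm i) => [|j]; first by rewrite expr0.
by rewrite exprS; apply: memM.
Qed.

Lemma mem_act (A : 'M[R]_3) (M : 'M[K]_(n, 4)) : (forall i c, M i c \in D) ->
  forall i c, act (map_mx C A) M i c \in D.
Proof.
move=> MD i c.
have mul m k l (B : 'M[K]_(m, k)) (B' : 'M[K]_(k, l)) :
    (forall i j, B i j \in D) -> (forall i j, B' i j \in D) -> forall i j, (B *m B') i j \in D.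
  move=> hB hB' r s; rewrite mxE.
  by apply: (big_ind (fun F : K => F \in D)) => // t _; apply: memM.
have AD (B : 'M[R]_3) r s : map_mx C B r s \in D by rewrite mxE.
have pD r s : point M i r s \in D.
  by rewrite mxE; case: r => -[|[|[|//]]] /= _.
have lD r s : line M i r s \in D.
  by rewrite mxE; case: s => -[|[|[|//]]] /= _ //; rewrite memN // memD // memM.
have wD : weight (map_mx C A) M i \in D by rewrite weightE; apply: mul.
rewrite mxE -map_invmx; case: c => -[|[|[|[|//]]]] /= _.
- by apply: mem_div => //; apply: mul.
- by apply: mem_div => //; apply: mul.
- by apply: memM => //; apply: mul.
- by apply: memM => //; apply: mul.
Qed.

Lemma mem_cross_section (s : nat -> K) : (forall j, s j \in D) ->
  forall i c, cross_section n s i c \in D.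
Proof.
move=> sD i; case: i => -[|[|[|k]]] lt; apply: ord4_ind; rewrite mxE //=;
  do ?[apply: mem_div | apply: memM | apply: memB | apply: memD | apply: memN];
  by [].
Qed.

End DivringClosure.

Lemma mem_mxvec (T : nmodType) (D : {pred T}) m k (A : 'M[T]_(m, k)) :
  (forall i j, A i j \in D) -> forall u, mxvec A 0 u \in D.
Proof. by move=> h u; case/mxvec_indexP: u => i j; rewrite mxvecE. Qed.

Lemma eq_quotients (F : fieldType) (p q a b : F) : q != 0 -> b != 0 ->
  a * q = b * p -> p / q = a / b.
Proof. by move=> q0 b0 e; apply/eqP; rewrite eqr_div // mulrC -e. Qed.

Lemma alg_indep_uniq (R : realType) N (S : seq {ratfun R[N]}) :
  alg_indep S -> uniq S.
Proof.
move=> hS; apply/(uniqP 0) => i j; rewrite !inE => iS jS e.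
have := hS ('X_(Ordinal iS) - 'X_(Ordinal jS)).
rewrite rmorphB /= !mmapX !mmap1U /= e subrr => /(_ erefl).
move/(congr1 (meval (fun k => (k == Ordinal iS)%:R))).
rewrite rmorphB /= !mevalXU rmorph0 eqxx => /eqP; rewrite subr_eq0.
by case: (Ordinal jS =P Ordinal iS) => [[] //|_]; rewrite oner_eq0.
Qed.

Lemma gen_field_algebraic (R : realType) N (S : seq {ratfun R[N]}) F :
  gen_field S F -> algebraic_over (gen_field S) F.
Proof.
move=> hF; exists ('X - F%:P); split; first by rewrite polyXsubC_eq0.
  move=> i D dD CD SD; have FD := hF D dD CD SD; have [D1 DB _] := dD.
  have D0 : 0 \in D by rewrite -(subrr 1) DB.
  by rewrite coefB coefX coefC; case: i => [|[|i]] /=; rewrite DB.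
by rewrite root_XsubC.
Qed.

(** * The field of invariants *)

Section Invariants.

Variables (R : realType) (n : nat) (hn : (4 <= n)%N).
Local Notation K := {ratfun R[n * 4]}.
Local Notation C := (ratC (n * 4)).
Local Notation X := (generic_config R n).

Lemma mmap_generic (P : {mpoly R[n * 4]}) : mmap C (mxvec X 0) P = P%:F.
Proof.
rewrite -mmap_ratX; congr (mmap _ _ P); apply/funext => i; exact: mxvec_generic.
Qed.

(** Substituting T X is undone by evaluating at T^-1 X. *)
Lemma subst_inj T (P : {mpoly R[n * 4]}) : T \in unitmx ->
  mmap C (fun v => mxvec (proj_config n T) 0 v) P = 0 -> P = 0.
Proof.
move=> uT; rewrite proj_configE // => P0.
have uT' : invmx T \in unitmx by rewrite unitmx_inv.
have rT' := real_regular n uT'; have := regular_inv rT'.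
rewrite -map_invmx invmxK => rT.
have h : has_value C (mxvec (act (map_mx C (invmx T)) X) 0)
    (mmap C (mxvec (act (map_mx C T) X) 0) P)
    (mmap C (mxvec (act (map_mx C T) (act (map_mx C (invmx T)) X)) 0) P).
  by apply: has_value_mmap; apply: has_value_mxvec => i c; apply: value_act.
have e : act (map_mx C T) (act (map_mx C (invmx T)) X) = X.
  by have := act_invK rT'; rewrite -map_invmx invmxK.
move: h; rewrite e mmap_generic P0 => /has_value_inj /(_ (has_value0 _ _)) /eqP.
by rewrite tofrac_eq0 => /eqP.
Qed.

(** In this form invariance is visibly preserved by the field operations, and it
    can be checked through any representation of F as a quotient. *)
Lemma abs_invariantE F : abs_invariant F <->
  forall T, T \in unitmx -> has_value C (mxvec (act (map_mx C T) X) 0) F F.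
Proof.
split=> h T uT.
  have [Q0 e] := ratfun_repr F.
  set P := \n_(repr F) in e; set Q := \d_(repr F) in Q0 e.
  exists P, Q; split=> //; last first.
    have := h T uT; rewrite {1}e /proj_subst ratsubst_quot //; last first.
      by move=> P'; apply: subst_inj.
    by rewrite proj_configE.
  by apply: contra_neq Q0; rewrite -proj_configE // => /(subst_inj uT).
have [P [Q [Q0 e e']]] := h T uT.
rewrite {1}e /proj_subst ratsubst_quot ?proj_configE //.
  by rewrite -proj_configE // => P'; apply: subst_inj.
by apply: contra_neq Q0 => ->; rewrite rmorph0.
Qed.

Lemma invs_invariant j : abs_invariant (invs hn X)`_j.
Proof.
apply/abs_invariantE => T uT; have rT := real_regular n uT.
have nX := generic_nondegenerate R hn.
rewrite -{2}(invs_act rT nX); apply: value_invs.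
exact: nondegenerate_act.
Qed.

Lemma abs_invariant_divring :
  GRing.divring_closed [pred F : K | `[<abs_invariant F>]].
Proof.
split=> [|F G|F G]; rewrite !inE.
- by apply/asboolP/abs_invariantE => T _; apply: has_value1.
- move=> /asboolP/abs_invariantE hF /asboolP/abs_invariantE hG.
  apply/asboolP/abs_invariantE => T uT.
  by apply: has_valueB; [apply: hF | apply: hG].
- move=> /asboolP/abs_invariantE hF /asboolP/abs_invariantE hG.
  apply/asboolP/abs_invariantE => T uT.
  have [->|G0] := eqVneq G 0; first by rewrite invr0 mulr0; apply: has_value0.
  by apply: has_value_div => //; [apply: hF | apply: hG].
Qed.

Lemma gen_field_invariant F : gen_field (invs hn X) F -> abs_invariant F.
Proof.
move=> /(_ _ abs_invariant_divring) h; apply/asboolP; apply: h => [c|G GS].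
  apply/asboolP/abs_invariantE => T _; exact: has_valueC.
by rewrite -(nth_index 0 GS); apply/asboolP/invs_invariant.
Qed.

(** The quotient F = P / Q may be of the form 0 / 0 at the normalized
    configuration s; the auxiliary real matrix A moves s away from the zeros
    of Q without leaving the field D. *)
Lemma invariant_gen_field F : abs_invariant F -> gen_field (invs hn X) F.
Proof.
move=> /abs_invariantE iF D dD CD SD.
have nX := generic_nondegenerate R hn; have rT := frame_regular nX.
set T0 := moving_frame hn X in rT; set s := act T0 X.
have sD i c : s i c \in D.
  have -> : s = cross_section n (fun j => (invs hn X)`_j).
    rewrite -(invs_act rT nX); apply: normalizedE; first exact: frame_normalized.
    exact: nondegenerate_act.
  apply: mem_cross_section => // j.
  have [js|js] := ltnP j (size (invs hn X)); first exact/SD/mem_nth.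
  by rewrite nth_default //; have := CD 0; rewrite rmorph0.
have [P [Q [Q0 eF]]] : exists P Q, Q != 0 /\ F = P%:F / Q%:F.
  by exists \n_(repr F), \d_(repr F); apply: ratfun_repr.
have QF0 : Q%:F != 0 :> K by rewrite tofrac_eq0.
pose val (G : {mpoly R[n * 4]}) M := mmap C (mxvec M 0) G.
have rat M G : rational_on (fun T => regular_at T M) (fun T => val G (act T M)).
  apply: rational_on_mmap => u; case/mxvec_indexP: u => i c.
  by apply: rational_on_ext (rational_on_act M i c) => T _; rewrite mxvecE.
have main T : regular_at T X ->
    val P (act T X) * Q%:F + val Q (act T X) * - P%:F = 0.
  apply: (@act_vanish K n X R C
    (fun T => val P (act T X) * Q%:F + val Q (act T X) * - P%:F)).
    by apply: rational_onD; apply: rational_onM; first [exact: rat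
      | exact/rational_on_poly/line_polyC].
  move=> A [uA _]; have {}uA : A \in unitmx by rewrite map_unitmx in uA.
  have h := iF A uA.
  have vP := has_value_poly C (mxvec (act (map_mx C A) X) 0) P.
  have vQ := has_value_poly C (mxvec (act (map_mx C A) X) 0) Q.
  have := has_valueM h vQ; have PF : P%:F = F * Q%:F by rewrite eF divfK.
  rewrite -PF => /has_value_inj /(_ vP) e.
  by rewrite /val -e PF mulrN mulrAC [_ * (F * _)]mulrC subrr.
have [A [rA QA]] : exists A,
    regular_at (map_mx C A) s /\ val Q (act (map_mx C A) s) != 0.
  apply: contrapT => h.
  have := @act_vanish K n s R C (fun T => val Q (act T s)) (rat s Q) _ _
    (regular_inv rT).
  rewrite act_invK // /val mmap_generic => h'.
  move: QF0; rewrite h' ?eqxx // => A rA; apply/eqP; apply: contrapT => /negP hA.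
  by apply: h; exists A.
have := main _ (regular_mul rT rA); rewrite act_mul // -/s mulrN => /eqP.
rewrite subr_eq0 => /eqP e.
have -> : F = val P (act (map_mx C A) s) / val Q (act (map_mx C A) s).
  by rewrite eF; apply: eq_quotients QF0 QA e.
have [_ _ Ddiv] := dD; have AsD := mem_act dD CD A sD.
by apply: Ddiv; apply: (mem_mmap dD CD) => u; apply: mem_mxvec.
Qed.

(** The relation P is evaluated at the cross-section point whose invariants are
    the variables themselves (and 1 beyond the last index), which gives P
    back. *)
Lemma invs_alg_indep : alg_indep (invs hn X).
Proof.
pose N := size (invs hn X); move=> P; rewrite -/N in P * => P0.
pose s j : {ratfun R[N]} := oapp (@ratX R N) 1 (insub j).
have two0 : 1 + 1 != 0 :> {ratfun R[N]}.
  by rewrite -(rmorph1 (ratC N)) -rmorphD fmorph_eq0 -mulr2n Num.Theory.pnatr_eq0.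
have nz (G : {mpoly R[N]}) (v : 'I_N -> R) :
    G.@[v] != 0 -> G%:F != 0 :> {ratfun R[N]}.
  by apply: contra_neq => /eqP; rewrite tofrac_eq0 => /eqP ->; rewrite rmorph0.
have s0 j : s j != 0.
  rewrite /s; case: insub => [i|] /=; last exact: oner_neq0.
  by apply: (nz _ (fun=> 1)); rewrite mevalXU oner_neq0.
have s1 j : 1 + s j != 0.
  rewrite /s; case: insub => [i|] /=; last exact: two0.
  rewrite /ratX -tofrac1 -tofracD; apply: (nz _ (fun=> 0)).
  by rewrite rmorphD /= mevalXU rmorph1 addr0 oner_neq0.
have nM := @cross_section_nondegenerate n hn _ _ s0 s1.
have h : has_value (ratC N) (mxvec (cross_section n s) 0)
    (mmap C (fun i : 'I_N => (invs hn X)`_i) P) (mmap (ratC N) (@ratX R N) P).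
  apply: has_value_mmap => i.
  have := value_invs (ratC N) i nM.
  rewrite (invs_cross_section hn s0 s1) -?(size_invs hn X) //.
  by rewrite /s insubT //= => lt; rewrite (_ : Sub _ _ = i) //; apply: val_inj.
move: h; rewrite P0 mmap_ratX => /has_value_inj /(_ (has_value0 _ _)) /eqP.
by rewrite tofrac_eq0 => /eqP.
Qed.

End Invariants.

Theorem theorem3 (R : realType) (n : nat) (hn : (4 <= n)%N) :
  [/\ forall F, F \in generators R hn -> abs_invariant F,
      uniq (generators R hn) /\ size (generators R hn) = (4 * n - 8)%N,
      alg_indep (generators R hn),
      transcendence_basis (generators R hn) (@abs_invariant R n) &
      forall F, abs_invariant F <-> gen_field (generators R hn) F].
Proof.
rewrite !generatorsE.
have inv F : F \in invs hn (generic_config R n) -> abs_invariant F.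
  by move=> FS; rewrite -(nth_index 0 FS); apply: invs_invariant.
have indep := @invs_alg_indep R n hn.
split=> //.
- by split; [apply: alg_indep_uniq | apply: size_invs].
- by split=> // F /(@invariant_gen_field R n hn)/gen_field_algebraic.
- by move=> F; split; [apply: invariant_gen_field | apply: gen_field_invariant].
Qed.
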